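(* Let $n\ge1$, let $x_1,\dots,x_n\in\mathbb{R}_{>0}$, and let $\alpha$ be a (weak) composition whose parts rearrange to the partition $\lambda$. Then the Markov chain on $\mathrm{bMLQ}(\alpha,n)$ defined by the (forward) bosonic ringing paths projects to the 0-TAZRP of type $(\lambda',n)$ via the map $\widetilde\Phi$, where $\lambda'$ is the conjugate partition of $\lambda$.
   Context: Fix $n\ge1$, $[n]=\{1,\dots,n\}$; sites are considered cyclically, $\mathbb{Z}_n=\{1,\dots,n\}$ with $n+1\equiv1$. $\mathcal{M}(n)$ is the set of finite multisets with entries in $[n]$. For a sequence $\alpha=(\alpha_1,\dots,\alpha_L)$ of nonnegative integers, $\mathrm{bMLQ}(\alpha,n)$ is the set of bosonic multiline queues of type $(\alpha,n)$: tuples $\mathbf{D}=(D_1,\dots,D_L)$ with $D_j\in\mathcal{M}(n)$, $|D_j|=\alpha_j$ (row 1 is the bottom row; the multiplicity of $j$ in $D_i$ is the number of particles at site $j$ of row $i$). $\widetilde{\mathcal{W}}$ is the set of words $(A_1,\dots,A_n)$ of finite multisets of positive integers, and $\widetilde{\mathcal{W}}(\mu,n)$ is the set of those for which the multiset union of the letters $A_1,\dots,A_n$ is the multiset of (positive) parts of the partition $\mu$. 0-TAZRP of type $(\mu,n)$: the continuous-time Markov chain on $\widetilde{\mathcal{W}}(\mu,n)$ in which, from a state $\widetilde w=(\widetilde w_1,\dots,\widetilde w_n)$, for each $j\in\mathbb{Z}_n$ with $\widetilde w_j\ne\emptyset$, one copy of $y=\max\widetilde w_j$ moves from site $j$ to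 site $j+1$ at rate $x_j^{-1}$; all other transitions have rate $0$. Markov chain on $\mathrm{bMLQ}(\alpha,n)$: for $\mathbf{D}=(D_1,\dots,D_L)$ and $i\in\mathbb{Z}_n$, the ringing path at site $i$ is the sequence $\mathfrak{a}_1,\dots,\mathfrak{a}_{L+1}$ with $\mathfrak{a}_1=i$ and, for $2\le j\le L+1$, $\mathfrak{a}_j=\mathfrak{a}_{j-1}$ if $\mathfrak{a}_{j-1}\notin D_{j-1}$ and $\mathfrak{a}_j=\mathfrak{a}_{j-1}+1$ otherwise. Let $\widetilde F_i(\mathbf{D})=(D_1',\dots,D_L')$ where $D_j'=D_j$ if $\mathfrak{a}_j\notin D_j$, and otherwise $D_j'$ is $D_j$ with one copy of $\mathfrak{a}_j$ replaced by $\mathfrak{a}_j+1$. In the chain, for each $i\in\mathbb{Z}_n$ there is a transition $\mathbf{D}\to\widetilde F_i(\mathbf{D})$ with rate $x_i^{-1}$ if column $i$ of $\mathbf{D}$ is nonempty (some $D_j$ contains $i$), and rate $1$ if column $i$ is empty (in which case $\widetilde F_i(\mathbf{D})=\mathbf{D}$). Projection of Markov chains: a continuous-time chain $\mathcal{A}$ on $S_{\mathcal{A}}$ projects to a chain $\mathcal{B}$ on $S_{\mathcal{B}}$ via a surjective map $p:S_{\mathcal{A}}\to S_{\mathcal{B}}$ if for all $b\ne b'$ in $S_{\mathcal{B}}$ and all $a\in S_{\mathcal{A}}$ with $p(a)=b$, $\mathrm{rate}_{\mathcal{B}}(b,b')=\sum_{a'\in S_{\mathcal{A}},\,p(a')=b'}\mathrm{rate}_{\mathcal{A}}(a,a')$.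 Pairing. For $A,B\in\mathcal{M}(n)$ ($A$ the lower row, $B$ the upper row), $\mathrm{cpair_b}(A,B)$ is: for $j=1,\dots,n$ in order, write '')'' once for each instance of $j$ in $B$ and then ''('' once for each instance of $j$ in $A$; view the bracket word on a circle and recursively match each ''('' with a '')'' following it cyclically when there are no unmatched brackets between them. A particle of $A$ or $B$ is paired (unpaired) if its bracket is matched (unmatched); particles are counted with multiplicity at each site. Operators $D^{(\ell)}$. For $D\in\mathcal{M}(n)$, $\ell\ge1$ and $\widetilde{\mathbf{u}}=(\widetilde u_1,\dots,\widetilde u_n)\in\widetilde{\mathcal{W}}$ with $\ell<\min\bigcup_i\widetilde u_i$, define $D^{(\ell)}(\widetilde{\mathbf{u}})=(Y_1,\dots,Y_n)\in\widetilde{\mathcal{W}}$ as follows. Initialize all $Y_j=\emptyset$. Let $a=\min\bigcup_i\widetilde u_i$, $K=\max\bigcup_i\widetilde u_i$, and let $\widetilde u^{(r)}\in\mathcal{M}(n)$ be the multiset in which $j$ has multiplicity equal to the number of elements $\ge r$ of $\widetilde u_j$. Pairing phase: let $s$ be the maximal $r\in\{a,\dots,K\}$ with $|\widetilde u^{(r)}|\ge|D|$, if it exists, and $s=a$ otherwise. For $r=K,K-1,\dots,s$: for each newly paired particle of $D$ at site $j$, add an element $r$ to $Y_j$ (the number of newly paired particles at site $j$ is the number of particles of $D$ at $j$ paired in $\mathrm{cpair_b}(D,\widetilde u^{(r)})$ minus the number paired in $\mathrm{cpair_b}(D,\widetilde u^{(r+1)})$). Then for each particle of $D$ unpaired in $\mathrm{cpair_b}(D,\widetilde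 u^{(s)})$, at site $j$ say, add an element $\ell$ to $Y_j$. Collapsing phase: for $r=s,s-1,\dots,a$: for each newly unpaired particle of $\widetilde u^{(r)}$ at site $j$, add an element $r-1$ to $Y_j$ (the number of newly unpaired particles at $j$ is the number of particles of $\widetilde u^{(r)}$ at $j$ unpaired in $\mathrm{cpair_b}(D,\widetilde u^{(r)})$ minus the number of particles of $\widetilde u^{(r+1)}$ at $j$ unpaired in $\mathrm{cpair_b}(D,\widetilde u^{(r+1)})$). For the empty word $\widetilde{\mathbf{w}}_0=(\emptyset,\dots,\emptyset)$, $D^{(\ell)}(\widetilde{\mathbf{w}}_0)$ has at site $j$ the multiset consisting of $\ell$ repeated as many times as $j$ occurs in $D$. Projection map: $\widetilde\Phi(\mathbf{D})=D_1^{(1)}\bigl(D_2^{(2)}(\cdots D_L^{(L)}(\widetilde{\mathbf{w}}_0)\cdots)\bigr)$. *)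

(* Defs.v *)
From HB Require Import structures.
From mathcomp Require Import all_boot all_order all_algebra.
From mathcomp Require Import finmap multiset.
From mathcomp Require Import all_classical reals.

Set Implicit Arguments.
Unset Strict Implicit.
Unset Printing Implicit Defensive.

Import Order.TTheory GRing.Theory Num.Theory.

Local Open Scope mset_scope.
Local Open Scope nat_scope.

(* Site j of {1, ..., n} is the ordinal j - 1 : 'I_n, and j + 1 (taken
   cyclically) is [ordS j].  Row i of a multiline queue D is entry i - 1 of D. *)

Section Combinatorics.
Variable n : nat.

Definition queue_row := {mset 'I_n}.
Definition word := n.-tuple {mset nat}.

Definition letters (w : word) : seq nat :=
  flatten [seq enum_mset A | A <- w].

Definition empty_word : word := [tuple mset0 | _ < n].

Definition bMLQ (L : nat) (alpha : L.-tuple nat) : set (L.-tuple queue_row) :=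
  [set D | forall i : 'I_L, size (enum_mset (tnth D i)) = tnth alpha i]%classic.

(* Letters are multisets over nat; this condition forces entries to be positive. *)
Definition multiset_words (mu : seq nat) : set word :=
  [set w | perm_eq (letters w) [seq p <- mu | 0 < p]]%classic.

Section Ringing.
Variable L : nat.
Implicit Type D : L.-tuple queue_row.

(* [ringing_path D i k] is the entry of index k + 1 of the ringing path. *)
Fixpoint ringing_path D (i : 'I_n) (k : nat) : 'I_n :=
  if k is k'.+1 then
    let a := ringing_path D i k' in
    if a \in nth mset0 D k' then ordS a else a
  else i.

Definition ring_step D (i : 'I_n) : L.-tuple queue_row :=
  [tuple let a := ringing_path D i k in
         let A := tnth D k in
         if a \in A then ordS a +` (A `\ a) else A | k < L].

Definition column_nonempty D (i : 'I_n) : bool :=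
  [exists k : 'I_L, i \in tnth D k].

End Ringing.

Definition letter_max (A : {mset nat}) : nat := \max_(y <- enum_mset A) y.

Definition hop (w : word) (j : 'I_n) : word :=
  [tuple let y := letter_max (tnth w j) in
         let A := if k == j then tnth w k `\ y else tnth w k in
         if k == ordS j then y +` A else A | k < n].

Definition bracket := ('I_n * bool)%type.
Definition opening (j : 'I_n) : bracket := (j, false).
Definition closing (j : 'I_n) : bracket := (j, true).

Definition bracket_word (A B : queue_row) : seq bracket :=
  flatten [seq nseq (B j) (closing j) ++ nseq (A j) (opening j)
          | j <- enum 'I_n].

(* r lies on the circle strictly after p and strictly before q *)
Definition cyc_between (N : nat) (p r q : 'I_N) : bool :=
  0 < (r + N - p) %% N < (q + N - p) %% N.

Section Matching.
Variable w : seq bracket.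
Let N := size w.

(* Given the set M of already matched positions, an unmatched "(" at p and an
   unmatched ")" at q get matched when no unmatched bracket lies between. *)
Definition matchable (M : {set 'I_N}) (p q : 'I_N) : bool :=
  [&& p \notin M, q \notin M,
      ~~ (tnth (in_tuple w) p).2, (tnth (in_tuple w) q).2
    & [forall r : 'I_N, cyc_between p r q ==> (r \in M)]].

Definition match_step (M : {set 'I_N}) : {set 'I_N} :=
  M :|: [set p | [exists q, matchable M p q || matchable M q p]].

(* Each step that is not stationary matches at least two new positions, so N
   iterations exhaust the recursion. *)
Definition matched : {set 'I_N} := iter N match_step finset.set0.

Definition count_matched (b : bracket) : nat :=
  #|[set p in matched | tnth (in_tuple w) p == b]|.

End Matching.

Definition paired_lower (A B : queue_row) (j : 'I_n) : nat :=
  count_matched (bracket_word A B) (opening j).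

Definition paired_upper (A B : queue_row) (j : 'I_n) : nat :=
  count_matched (bracket_word A B) (closing j).

Definition unpaired_lower (A B : queue_row) (j : 'I_n) : nat :=
  A j - paired_lower A B j.

Definition unpaired_upper (A B : queue_row) (j : 'I_n) : nat :=
  B j - paired_upper A B j.

Definition word_max (u : word) : nat := \max_(y <- letters u) y.

Definition word_min (u : word) : nat :=
  \big[minn/word_max u]_(y <- letters u) y.

Definition level (u : word) (r : nat) : queue_row :=
  seq_mset (flatten [seq nseq (count (leq r) (enum_mset (tnth u j))) j
                    | j <- enum 'I_n]).

(* The default value of [last] covers the case where no r qualifies. *)
Definition pairing_bound (D : queue_row) (u : word) : nat :=
  last (word_min u)
       [seq r <- index_iota (word_min u) (word_max u).+1
       | size (enum_mset D) <= size (enum_mset (level u r))].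

Definition newly_paired (D : queue_row) (u : word) (r : nat) (j : 'I_n) : nat :=
  paired_lower D (level u r) j - paired_lower D (level u r.+1) j.

Definition newly_unpaired (D : queue_row) (u : word) (r : nat) (j : 'I_n) : nat :=
  unpaired_upper D (level u r) j - unpaired_upper D (level u r.+1) j.

Definition row_op_letter (l : nat) (D : queue_row) (u : word) (j : 'I_n) : {mset nat} :=
  let a := word_min u in
  let K := word_max u in
  let s := pairing_bound D u in
  seq_mset (
    flatten [seq nseq (newly_paired D u r j) r | r <- index_iota s K.+1]
    ++ nseq (unpaired_lower D (level u s) j) l
    ++ flatten [seq nseq (newly_unpaired D u r j) r.-1
               | r <- index_iota a s.+1]).

(* Only meaningful when l is smaller than every letter of u. *)
Definition row_op (l : nat) (D : queue_row) (u : word) : word :=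
  if u == empty_word then [tuple msetn (D j) l | j < n]
  else [tuple row_op_letter l D u j | j < n].

Definition Phi (L : nat) (D : L.-tuple queue_row) : word :=
  foldr (fun lD u => row_op lD.1 lD.2 u) empty_word (zip (iota 1 L) D).

End Combinatorics.

(* Partitions may carry trailing zeros; they do not affect [conj_part], and
   [rearranges_to] compares only the positive parts. *)
Definition is_partition (la : seq nat) : bool := sorted geq la.

Definition conj_part (la : seq nat) : seq nat :=
  mkseq (fun i => count (fun p => i < p) la) (head 0 la).

Definition rearranges_to (alpha la : seq nat) : bool :=
  perm_eq [seq p <- alpha | 0 < p] [seq p <- la | 0 < p].

Record chain (R : realType) (T : choiceType) := Chain {
  states : set T;
  rate : T -> T -> R }.

(* The sum over a' is a finitely supported sum; it is the honest sum because
   the chains below have finitely many transitions out of each state. *)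
Definition projects_to (R : realType) (S T : choiceType)
    (A : chain R S) (B : chain R T) (p : S -> T) : Prop :=
  (p @` states A = states B)%classic /\
  forall (b b' : T) (a : S),
    states B b -> states B b' -> b <> b' -> states A a -> p a = b ->
    (rate B b b' =
       \sum_(a' \in [set a' | states A a' /\ p a' = b']%classic) rate A a a')%R.

Definition bMLQ_chain (R : realType) (n L : nat) (x : 'I_n -> R)
    (alpha : L.-tuple nat) : chain R (L.-tuple (queue_row n)) :=
  Chain (bMLQ (n:=n) alpha)
    (fun D D' => (\sum_(i < n | ring_step D i == D')
                    if column_nonempty D i then (x i)^-1 else 1)%R).

Definition TAZRP0 (R : realType) (n : nat) (x : 'I_n -> R) (mu : seq nat) :
    chain R (word n) :=
  Chain (multiset_words (n:=n) mu)
    (fun w w' => (\sum_(j < n | (tnth w j != mset0) && (hop w j == w'))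
                    (x j)^-1)%R).

(* Main.v *)
Require Import Defs.
From mathcomp Require Import all_boot all_order all_algebra.
From mathcomp Require Import finmap multiset zify.
From mathcomp Require Import all_classical reals.

(** A word w is the same thing as the nested family of rows w^(r), where w^(r)
    has at site j as many particles as w has letters >= r at j
    ([profile], [word_eq]).  The proof works one r at a time, because both sides
    of the theorem become local there.

    - A hop at site i moves the largest letter of the site, so it acts on every
      w^(r) by the same elementary move: if site i is occupied, one particle goes
      to the next site ([slide], [profile_hop]).  The rule survives for an empty
      site, where nothing moves.

    - The two phases of D^(l) collapse into one formula: for r > l, the row
      (D^(l) u)^(r) consists of the particles of D paired with u^(r) together
      with the particles of u^(r+1) left unpaired by D; for r <= l, all of D
      replaces the first summand, and u^(l+1) stands for u^(r+1)
      ([profile_row_op]).  At most one summand carries information, since the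
      smaller of the two rows is always completely paired.

    So the ringing path commutes with Phi as soon as the cyclic pairing of two
    rows A (lower) and B (upper) behaves well when a particle of A is pushed from
    i to i + 1 and then a particle of B is pushed from the site reached by the
    path ([paired_lower_advance], [lower_with_unpaired_advance]).  The pairing is
    a queue: opening brackets arrive, closing brackets are served, and a cyclic
    solution of the queue recursion determines which brackets are matched
    ([forward_pairing], [backward_pairing]).  A push changes a solution at one or
    two sites only, so these facts are checked by hand ([forward_slide],
    [backward_slide]).  The result is [Phi_ring_step]: ringing at i changes the
    image by the hop at i, or by nothing when site i of the image is empty.
    The rates then agree, because a nonempty site of the image lies in a
    nonempty column of the queue ([Phi_nonempty]).

    On the sizes of the rows w^(r), adding a row to the queue is insertion into a
    decreasing list ([nth_insert_desc]), which gives the type of the image: the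
    sizes are the parts of lambda, so the letters are those of its conjugate.
    Surjectivity needs no inverse of Phi: the image is nonempty and stable under
    hops, and hops connect all words of a given type ([reaches_place]). *)

Set Implicit Arguments.
Unset Strict Implicit.
Unset Printing Implicit Defensive.

Local Open Scope mset_scope.
Local Open Scope nat_scope.

(** * Cyclic bracket matching *)

Lemma cyc_distE (N : nat) (a b : 'I_N) :
  (b + N - a) %% N = if a <= b then b - a else b + N - a.
Proof.
have aN := ltn_ord a; have bN := ltn_ord b.
case: leqP => ab; last by rewrite modn_small //; lia.
by rewrite addnC -addnBA // modnDl modn_small //; lia.
Qed.

(** A form without modular arithmetic, on which linear arithmetic decides
    every fact about cyclic order used below. *)
Lemma cyc_betweenE (N : nat) (p r q : 'I_N) :
  cyc_between p r q =
    (p < r < q) || (q < p) && ((p < r) || (r < q)).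
Proof.
rewrite /cyc_between !cyc_distE.
have := (ltn_ord p, ltn_ord q, ltn_ord r) => -[[]] *.
by do ![case: ifP => ?]; lia.
Qed.

Section Matching.
Variables (n : nat) (w : seq (bracket n)).
Notation N := (size w).
Notation closes p := (tnth (in_tuple w) p).2.
Implicit Types (M : {set 'I_N}) (P : pred 'I_N).

Definition balanced P := \sum_(p | P p) ~~ closes p = \sum_(p | P p) closes p.

Lemma eq_balanced P P' : P =1 P' -> balanced P -> balanced P'.
Proof.
by move=> PP'; rewrite /balanced -2!(eq_bigl _ _ PP').
Qed.

(** A second partner would lie between [x] and the first one (or conversely),
    hence would be matched already. *)
Lemma matchable_funl M x y y' :
  matchable M x y -> matchable M x y' -> y = y'.
Proof.
move=> /and5P[xM yM xo yc /forallP xyM] /and5P[_ y'M _ y'c /forallP xy'M].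
apply/eqP; apply: contraT => /negP yy'; exfalso.
have: cyc_between x y y' || cyc_between x y' y.
  have xy: x != y by apply: contraNneq xo => ->.
  have xy': x != y' by apply: contraNneq xo => ->.
  by rewrite !cyc_betweenE; move: yy' xy xy'; rewrite -!val_eqE /=; lia.
by case/orP => H; [move: (xy'M y)|move: (xyM y')]; rewrite H /= => K;
  [rewrite K in yM|rewrite K in y'M].
Qed.

Lemma matchable_funr M x x' y :
  matchable M x y -> matchable M x' y -> x = x'.
Proof.
move=> /and5P[xM yM xo yc /forallP xyM] /and5P[x'M _ x'o _ /forallP x'yM].
apply/eqP; apply: contraT => /negP xx'; exfalso.
have: cyc_between x x' y || cyc_between x' x y.
  have xy: x != y by apply: contraNneq xo => ->.
  have x'y: x' != y by apply: contraNneq x'o => ->.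
  by rewrite !cyc_betweenE; move: xx' xy x'y; rewrite -!val_eqE /=; lia.
by case/orP => H; [move: (xyM x')|move: (x'yM x)]; rewrite H /= => K;
  [rewrite K in x'M|rewrite K in xM].
Qed.

Lemma in_match_step M p :
  (p \in match_step M) =
    (p \in M) || [exists q, matchable M p q || matchable M q p].
Proof. by rewrite !inE. Qed.

(** Each newly matched opening bracket has exactly one partner; this and its
    mirror image let the new brackets be counted in pairs. *)
Lemma sum_matchable_r M x :
  \sum_y (matchable M x y : nat) =
    [&& x \in match_step M, x \notin M & ~~ closes x].
Proof.
case: (pickP (matchable M x)) => [y xy|none].
  rewrite (bigD1 y) //= xy big1 ?addn0; last first.
    move=> y' /eqP y'y; case xy': (matchable _ _ _) => //.
    by case: y'y; apply: matchable_funl xy' xy.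
  move: (xy) => /and5P[-> _ -> _ _].
  rewrite in_match_step (introT existsP) ?orbT //.
  by exists y; rewrite xy.
rewrite big1 => [|y _]; last by rewrite none.
apply/esym/eqP; rewrite eqb0; apply/and3P => -[xs xM xo].
move: xs; rewrite in_match_step (negbTE xM) /= => /existsP[q].
by rewrite none /= => /and5P[_ _ _]; rewrite (negbTE xo).
Qed.

Lemma sum_matchable_l M y :
  \sum_x (matchable M x y : nat) =
    [&& y \in match_step M, y \notin M & closes y].
Proof.
case: (pickP (matchable M ^~ y)) => [x xy|none].
  rewrite (bigD1 x) //= xy big1 ?addn0; last first.
    move=> x' /eqP x'x; case x'y: (matchable _ _ _) => //.
    by case: x'x; apply: matchable_funr x'y xy.
  move: (xy) => /and5P[_ -> _ -> _].
  rewrite in_match_step (introT existsP) ?orbT //.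
  by exists x; rewrite xy orbT.
rewrite big1 => [|x _]; last by rewrite none.
apply/esym/eqP; rewrite eqb0; apply/and3P => -[ys yM yc].
move: ys; rewrite in_match_step (negbTE yM) /= => /existsP[q].
by rewrite none orbF => /and5P[_ _]; rewrite yc.
Qed.

(** New brackets come in partner pairs, so any condition that does not
    separate partners selects as many openings as closings. *)
Lemma balanced_new M P :
  (forall x y, matchable M x y -> P x = P y) ->
  balanced (fun r => [&& r \in match_step M, r \notin M & P r]).
Proof.
move=> Pxy; rewrite /balanced.
transitivity (\sum_(x | P x) \sum_y (matchable M x y : nat)).
  rewrite big_mkcond [RHS]big_mkcond; apply: eq_bigr => x _.
  rewrite sum_matchable_r.
  by case: (P x); case: (x \in match_step M); case: (x \in M).
transitivity (\sum_(y | P y) \sum_x (matchable M x y : nat)).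
  rewrite exchange_big [RHS]big_mkcond; apply: eq_bigr => y _.
  rewrite big_mkcond; case Py: (P y).
    apply: eq_bigr => x _; case Px: (P x) => //.
    by case xy: (matchable M x y) => //; rewrite (Pxy x y) ?Py // in Px.
  rewrite big1 // => x _; case Px: (P x) => //.
  by case xy: (matchable M x y) => //; rewrite (Pxy x y) ?Py // in Px.
rewrite big_mkcond [RHS]big_mkcond; apply: eq_bigr => x _.
rewrite sum_matchable_l.
by case: (P x); case: (x \in match_step M); case: (x \in M).
Qed.

Lemma balanced_step M P :
  (forall x y, matchable M x y -> P x = P y) ->
  balanced (fun r => (r \in M) && P r) ->
  balanced (fun r => (r \in match_step M) && P r).
Proof.
move=> Pxy balM; have := balanced_new Pxy; move: balM; rewrite /balanced.
have split (F : 'I_N -> nat) :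
  \sum_(p | (p \in match_step M) && P p) F p =
    \sum_(p | (p \in M) && P p) F p +
    \sum_(p | [&& p \in match_step M, p \notin M & P p]) F p.
  rewrite (bigID (fun r => r \in M)) /=; congr (_ + _); apply: eq_bigl => p.
    by rewrite in_match_step; case: (p \in M); case: (P p); rewrite ?andbF.
  by case: (p \in M); case: (P p); rewrite ?andbF ?andbT.
by rewrite !split => -> ->.
Qed.

(** The invariant of the matching: the matched brackets lying between any two
    unmatched ones balance.  A pair matched later encloses only matched
    brackets, so this is what makes the heights at its two ends agree. *)
Definition well_nested M :=
  balanced (mem M) /\
  forall p q, p \notin M -> q \notin M ->
    balanced (fun r => (r \in M) && cyc_between p r q).

(** A new pair [x], [y] cannot straddle a bracket that stays unmatched, since
    everything between [x] and [y] is matched. *)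
Lemma well_nested_step M : well_nested M -> well_nested (match_step M).
Proof.
case=> balM arcM; split.
  apply/(eq_balanced (P := fun r => (r \in match_step M) && true)).
    by move=> r; rewrite andbT.
  apply: balanced_step => //; apply: eq_balanced balM => r.
  by rewrite andbT.
move=> p q ps qs; apply: balanced_step; last first.
  by apply: arcM; [move: ps|move: qs]; rewrite in_match_step; case: (_ \in M).
move=> x y xy.
have xs : x \in match_step M.
  by rewrite in_match_step; apply/orP; right; apply/existsP; exists y; rewrite xy.
have ys : y \in match_step M.
  rewrite in_match_step; apply/orP; right.
  by apply/existsP; exists x; rewrite xy orbT.
have neq (a b : 'I_N) : a \in match_step M -> b \notin match_step M -> a != b :> nat.
  by move=> ax bx; apply: contraNneq bx => /val_inj <-.
have px := neq _ _ xs ps; have py := neq _ _ ys ps.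
have qx := neq _ _ xs qs; have qy := neq _ _ ys qs.
move: xy => /and5P[xM yM xo yc /forallP xyM].
have notin (r : 'I_N) : r \notin match_step M -> ~~ cyc_between x r y.
  move=> rs; apply: contra rs => bet.
  by rewrite in_match_step; have := xyM r; rewrite bet /= => ->.
have := notin p ps; have := notin q qs.
have xneqy : x != y :> nat by apply: contraNneq xo => /val_inj ->.
by rewrite !cyc_betweenE; move: px py qx qy xneqy; clear; lia.
Qed.

Lemma well_nested_iter k : well_nested (iter k (@match_step n w) finset.set0).
Proof.
elim: k => [|k IH] /=; last exact: well_nested_step.
by split=> [|p q _ _]; rewrite /balanced !big_pred0 // => r; rewrite /= inE.
Qed.

Lemma sub_match_step M p : p \in M -> p \in match_step M.
Proof. by rewrite in_match_step => ->. Qed.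

(** The matched set gains at least one position at each step until it is
    stationary, and there are only [N] positions. *)
Lemma match_step_matched : match_step (matched w) = matched w.
Proof.
rewrite /matched.
suff grow k : match_step (iter k (@match_step n w) finset.set0)
    = iter k (@match_step n w) finset.set0
  \/ k <= #|iter k (@match_step n w) finset.set0|.
  case: (grow N) => // full.
  have -> : iter N (@match_step n w) finset.set0 = [set: 'I_N]%SET.
    by apply/eqP; rewrite eqEcard finset.subsetT cardsT card_ord.
  by apply/setP => p; rewrite in_match_step !inE.
elim: k => [|k [IH|IH]] /=; [by right|by left; rewrite !IH|].
set M := iter k _ _ in IH *.
have [eqM|neq] := eqVneq (match_step M) M; first by left; rewrite !eqM.
right; apply: (leq_ltn_trans IH); apply: proper_card.
rewrite finset.properEneq eq_sym neq /=; apply/fintype.subsetP => p.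
exact: sub_match_step.
Qed.

(** An unmatched opening and an unmatched closing at minimal cyclic distance
    would have only matched brackets between them, so the next step would
    match them. *)
Lemma matched_saturated x y :
  ~~ closes x -> closes y -> (x \in matched w) || (y \in matched w).
Proof.
set M := matched w.
have [m] := ubnP ((y + N - x) %% N); elim: m x y => // m IH x y lem xo yc.
apply: contraT; rewrite negb_or => /andP[xM yM].
have xy : x != y :> nat by apply: contraNneq xo => /val_inj ->.
case: (pickP (fun r => cyc_between x r y && (r \notin M))) => [r|none].
  move=> /andP[bet rM].
  have [rc|ro] := boolP (closes r).
    have: (x \in M) || (r \in M).
      apply: IH => //; have := (ltn_ord x, ltn_ord y, ltn_ord r).
      move: bet lem xy; rewrite cyc_betweenE !cyc_distE => + + + [[]].
      by do ![case: ifP => ?]; lia.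
    by rewrite (negbTE xM) (negbTE rM).
  have: (r \in M) || (y \in M).
    apply: IH => //; have := (ltn_ord x, ltn_ord y, ltn_ord r).
    move: bet lem xy; rewrite cyc_betweenE !cyc_distE => + + + [[]].
    by do ![case: ifP => ?]; lia.
  by rewrite (negbTE yM) (negbTE rM).
have: x \in match_step M.
  rewrite in_match_step; apply/orP; right; apply/existsP; exists y.
  rewrite /matchable xM yM xo yc /=; apply/orP; left; apply/forallP => r.
  by have := none r; case: (r \in M); rewrite ?implybT //= andbT => ->.
by rewrite match_step_matched (negbTE xM).
Qed.

(** Summation of a one-step inequality along the arc from [x] to [y], which
    may wrap around the word.  Having both [v] and [v'] covers functions
    controlled from either direction. *)
Lemma arc_weight (v v' : nat -> nat) (a b : 'I_N -> nat) (x y : 'I_N) :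
  v N = v 0 -> v' N = v' 0 ->
  (forall p : 'I_N, v p + v' p.+1 + a p <= v p.+1 + v' p + b p) ->
  x != y ->
  v x.+1 + v' y + \sum_(r | cyc_between x r y) a r
    <= v y + v' x.+1 + \sum_(r | cyc_between x r y) b r.
Proof.
move=> vN v'N step xy.
have seg i j : i <= j -> j <= N ->
    v i + v' j + \sum_(r < N | i <= r < j) a r
      <= v j + v' i + \sum_(r < N | i <= r < j) b r.
  move=> ij; elim: j ij => [|j IH] ij jN.
    have -> : i = 0 by lia.
    by rewrite !big1 // => r; rewrite ltn0 andbF.
  have [ij'|ij'] := leqP i j; last first.
    have -> : i = j.+1 by lia.
    by rewrite !big1 // => r; lia.
  have {}IH := IH ij' (ltnW jN).
  have one (F : 'I_N -> nat) : \sum_(r < N | i <= r < j.+1) F r =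
      \sum_(r < N | i <= r < j) F r + F (Ordinal jN).
    rewrite (bigD1 (Ordinal jN)) /= ?ij' ?ltnSn // addnC; congr (_ + _).
    by apply: eq_bigl => r; rewrite -val_eqE /=; lia.
  move: IH (step (Ordinal jN)); rewrite !one /=.
  move: (\sum_(r < N | i <= r < j) a r) (\sum_(r < N | i <= r < j) b r).
  by move: (a (Ordinal jN)) (b (Ordinal jN)) => *; lia.
have xN := ltn_ord x; have yN := ltn_ord y.
have [lt|le] := ltnP x y.
  have bE r : cyc_between x r y = (x.+1 <= r < y) by rewrite cyc_betweenE; lia.
  by rewrite !(eq_bigl _ _ bE); exact: seg x.+1 y lt (ltnW yN).
have lt : y < x by move: xy; rewrite -val_eqE /=; lia.
have bE (F : 'I_N -> nat) : \sum_(r | cyc_between x r y) F r =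
    \sum_(r < N | x.+1 <= r < N) F r + \sum_(r < N | 0 <= r < y) F r.
  rewrite (bigID (fun r : 'I_N => x < r)) /=; congr (_ + _);
    apply: eq_bigl => r; rewrite cyc_betweenE; have := ltn_ord r; lia.
rewrite !bE; have := seg x.+1 N xN (leqnn N).
have := seg 0 y (leq0n _) (ltnW yN); rewrite vN v'N.
move: (\sum_(r < N | _) a r) (\sum_(r < N | _) b r) => a1 b1.
by move: (\sum_(r < N | _) a r) (\sum_(r < N | _) b r) => *; lia.
Qed.

(** The arc between partners is balanced, so the weights on its interior
    cancel. *)
Lemma matched_arc (a b : 'I_N -> nat) (v v' : nat -> nat) M (x y : 'I_N) :
  well_nested M -> matchable M x y ->
  (a = (fun p => ~~ closes p : nat) /\ b = (fun p => closes p : nat)) \/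
  (b = (fun p => ~~ closes p : nat) /\ a = (fun p => closes p : nat)) ->
  v N = v 0 -> v' N = v' 0 ->
  (forall p : 'I_N, v p + v' p.+1 + a p <= v p.+1 + v' p + b p) ->
  v x.+1 + v' y <= v y + v' x.+1.
Proof.
move=> [_ wn] /and5P[xM yM xo yc /forallP xyM] ab vN v'N step.
have xy : x != y by apply: contraNneq xo => ->.
have := arc_weight vN v'N step xy.
have /eq_balanced bal := wn x y xM yM.
have {bal} : balanced (fun r => cyc_between x r y).
  apply: bal => r; have := xyM r.
  by case: (cyc_between x r y); rewrite ?andbF //= => ->.
rewrite /balanced => bal.
by case: ab => -[-> ->]; rewrite bal leq_add2r.
Qed.

Lemma matched_ind (Q : pred 'I_N) :
  (forall M x y, well_nested M -> matchable M x y -> Q x /\ Q y) ->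
  forall p, p \in matched w -> Q p.
Proof.
move=> HQ p; suff HQk k q :
  q \in iter k (@match_step n w) finset.set0 -> Q q by exact: HQk.
elim: k q => [|k IH] q /=; first by rewrite inE.
rewrite in_match_step => /orP[/IH //|/existsP[r /orP[]]] /HQ;
  by move=> /(_ (well_nested_iter k))[].
Qed.

Definition n_opening := \sum_p ~~ closes p.
Definition n_closing := \sum_p closes p.

Lemma sum_rotate (f : nat -> nat) : f N = f 0 ->
  \sum_(p < N) f p.+1 = \sum_(p < N) f p.
Proof.
move=> fN; apply/eqP; rewrite -(eqn_add2l (f 0)).
by rewrite -(big_ord_recl N f) big_ord_recr /= fN addnC.
Qed.

(** A predicate contained in another one and not rarer than it is equal to
    it. *)
Lemma eq_in_sum_le (a b : pred 'I_N) :
  (forall p, a p -> b p) -> \sum_p (b p : nat) <= \sum_p (a p : nat) -> a =1 b.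
Proof.
move=> ab le p; apply/idP/idP => [/ab //|bp]; apply: contraT => nap.
move: le; rewrite (bigD1 p) //= [X in _ <= X](bigD1 p) //= bp (negbTE nap).
rewrite add0n add1n ltnNge => /negP[].
by apply: leq_sum => i _; case ai: (a i) => //; rewrite (ab _ ai).
Qed.

(** Here [f] is the length of a queue read from left to right: openings
    arrive, closings serve.  The arc inequality shows that every matched closing
    finds a nonempty queue.  Conversely, summing the recursion over the circle
    shows that the closings that find an empty queue are exactly as many as the
    unmatched ones. *)
Lemma matched_closing (f : nat -> nat) :
  n_opening <= n_closing -> f N = f 0 ->
  (forall p : 'I_N, f p.+1 = if closes p then (f p).-1 else (f p).+1) ->
  (forall p, ~~ closes p -> p \in matched w) /\
  (forall p, closes p -> (p \in matched w) = (0 < f p)).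
Proof.
move=> oc fN fS; have [balU _] : well_nested (matched w) by exact: well_nested_iter.
pose o1 := \sum_(p | p \in matched w) ~~ closes p.
pose o2 := \sum_(p | p \notin matched w) ~~ closes p.
pose c1 := \sum_(p | p \in matched w) closes p.
pose c2 := \sum_(p | p \notin matched w) closes p.
have {}balU : o1 = c1 by exact: balU.
have oU : n_opening = o1 + o2 by rewrite /n_opening (bigID (mem (matched w))).
have cU : n_closing = c1 + c2 by rewrite /n_closing (bigID (mem (matched w))).
have opens p : ~~ closes p -> p \in matched w.
  move=> po; apply: contraT => pU.
  have c0 : c2 = 0.
    apply: big1 => q qU; case qc: (closes q) => //.
    by have := matched_saturated po qc; rewrite (negbTE pU) (negbTE qU).
  have : o2 > 0 by rewrite /o2 (bigD1 p) //= po.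
  by move: oc oU cU; lia.
split=> // p pc.
have pos p' : p' \in matched w -> closes p' ==> (0 < f p').
  apply: (@matched_ind (fun p' => closes p' ==> (0 < f p'))) => M x y wn xy.
  have /and5P[_ _ xo yc _] := xy; rewrite (negbTE xo) yc /=; split => //.
  have := @matched_arc (fun p => ~~ closes p : nat) (fun p => closes p : nat)
     f (fun=> 0) M x y wn xy (or_introl (conj erefl erefl)) fN erefl.
  rewrite fS (negbTE xo) => H; suff : (f x).+1 + 0 <= f y + 0 by lia.
  by apply: H => q; rewrite fS; case: (closes q) => /=; lia.
pose z := \sum_p (closes p && (f p == 0)).
suff /eq_in_sum_le/(_ p) : \sum_p (closes p && (p \notin matched w) : nat) <= z.
  rewrite pc /= lt0n => ->; first by rewrite negbK.
  move=> q /andP[qc fq].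
  by rewrite qc; apply: contraL fq => /pos; rewrite qc -lt0n.
have -> : \sum_p (closes p && (p \notin matched w) : nat) = c2.
  rewrite /c2 [RHS]big_mkcond; apply: eq_bigr => q _.
  by case: (closes q); case: (q \in matched w).
have H2 : o2 = 0.
  by apply: big1 => q; apply: contraNeq => qc; apply: opens; case: (closes q) qc.
have H3 : \sum_(p < N) f p.+1 + n_closing = \sum_(p < N) f p + n_opening + z.
  rewrite -!big_split; apply: eq_bigr => q _ /=.
  by rewrite fS; case: (closes q); case: (f q) => *; rewrite /=; lia.
rewrite sum_rotate // in H3.
by move: H3; move: (\sum_(p < N) f p) => *; lia.
Qed.

(** The mirror image of [matched_closing], with the queue read from right to
    left. *)
Lemma matched_opening (g : nat -> nat) :
  n_closing <= n_opening -> g N = g 0 ->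
  (forall p : 'I_N, g p = if closes p then (g p.+1).+1 else (g p.+1).-1) ->
  (forall p, closes p -> p \in matched w) /\
  (forall p, ~~ closes p -> (p \in matched w) = (0 < g p.+1)).
Proof.
move=> oc gN gS; have [balU _] : well_nested (matched w) by exact: well_nested_iter.
pose o1 := \sum_(p | p \in matched w) ~~ closes p.
pose o2 := \sum_(p | p \notin matched w) ~~ closes p.
pose c1 := \sum_(p | p \in matched w) closes p.
pose c2 := \sum_(p | p \notin matched w) closes p.
have {}balU : o1 = c1 by exact: balU.
have oU : n_opening = o1 + o2 by rewrite /n_opening (bigID (mem (matched w))).
have cU : n_closing = c1 + c2 by rewrite /n_closing (bigID (mem (matched w))).
have closing p : closes p -> p \in matched w.
  move=> pc; apply: contraT => pU.
  have o0 : o2 = 0.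
    apply: big1 => q qU; case qo: (closes q) => //.
    by have := matched_saturated (negbT qo) pc; rewrite (negbTE pU) (negbTE qU).
  have : c2 > 0 by rewrite /c2 (bigD1 p) //= pc.
  by move: oc oU cU; lia.
split=> // p po.
have pos p' : p' \in matched w -> ~~ closes p' ==> (0 < g p'.+1).
  apply: (@matched_ind (fun p' => ~~ closes p' ==> (0 < g p'.+1))) => M x y wn xy.
  have /and5P[_ _ xo yc _] := xy; rewrite xo yc /=; split => //.
  have := @matched_arc (fun p => closes p : nat) (fun p => ~~ closes p : nat)
     (fun=> 0) g M x y wn xy (or_intror (conj erefl erefl)) erefl gN.
  rewrite [g y]gS yc => H; suff : 0 + (g y.+1).+1 <= 0 + g x.+1 by lia.
  by apply: H => q; rewrite [g q]gS; case: (closes q) => /=; lia.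
pose z := \sum_p (~~ closes p && (g p.+1 == 0)).
suff /eq_in_sum_le/(_ p) : \sum_p (~~ closes p && (p \notin matched w) : nat) <= z.
  rewrite po /= lt0n => ->; first by rewrite negbK.
  move=> q /andP[qo gq].
  by rewrite qo; apply: contraL gq => /pos; rewrite qo -lt0n.
have -> : \sum_p (~~ closes p && (p \notin matched w) : nat) = o2.
  rewrite /o2 [RHS]big_mkcond; apply: eq_bigr => q _.
  by case: (closes q); case: (q \in matched w).
have H2 : c2 = 0.
  by apply: big1 => q; apply: contraNeq => qc; apply: closing; case: (closes q) qc.
have H3 : \sum_(p < N) g p + n_opening = \sum_(p < N) g p.+1 + n_closing + z.
  rewrite -!big_split; apply: eq_bigr => q _ /=.
  by rewrite [g q]gS; case: (closes q); case: (g q.+1) => *; rewrite /=; lia.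
rewrite sum_rotate // in H3.
by move: H3; move: (\sum_(p < N) g p) => *; lia.
Qed.

End Matching.

(** * Pairing of two rows as a queue *)

Section Scan.
Variable n : nat.
Implicit Types (s t : seq (bracket n)) (b c : bracket n).

Definition scan x c := if c.2 then x.-1 else x.+1.
Definition backscan c x := if c.2 then x.+1 else x.-1.

(** Counting along the list instead of over positions makes the count split
    over the blocks of a bracket word. *)
Fixpoint busy x b s :=
  if s is c :: s' then ((c == b) && (0 < x)) + busy (scan x c) b s' else 0.

Fixpoint backbusy x b s :=
  if s is c :: s' then ((c == b) && (0 < foldr backscan x s')) + backbusy x b s'
  else 0.

Lemma busyE x b s :
  busy x b s =
    \sum_(p < size s) ((tnth (in_tuple s) p == b) && (0 < foldl scan x (take p s))).
Proof.
under eq_bigr do rewrite (tnth_nth b).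
elim: s x => [|c s IH] x; first by rewrite big_ord0.
by rewrite /= big_ord_recl /= IH.
Qed.

Lemma backbusyE x b s :
  backbusy x b s =
    \sum_(p < size s) ((tnth (in_tuple s) p == b) &&
                       (0 < foldr backscan x (drop p.+1 s))).
Proof.
under eq_bigr do rewrite (tnth_nth b).
elim: s x => [|c s IH] x; first by rewrite big_ord0.
by rewrite /= big_ord_recl /= IH drop0.
Qed.

Lemma busy_cat x b s t :
  busy x b (s ++ t) = busy x b s + busy (foldl scan x s) b t.
Proof. by elim: s x => [|c s IH] x //=; rewrite IH addnA. Qed.

Lemma backbusy_cat x b s t :
  backbusy x b (s ++ t) = backbusy (foldr backscan x t) b s + backbusy x b t.
Proof. by elim: s => [|c s IH] //=; rewrite IH foldr_cat addnA. Qed.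

Lemma foldl_nseq_closing x k j : foldl scan x (nseq k (closing j)) = x - k.
Proof. by elim: k x => [|k IH] x /=; rewrite ?subn0 // IH /scan /=; lia. Qed.

Lemma foldl_nseq_opening x k j : foldl scan x (nseq k (opening j)) = x + k.
Proof. by elim: k x => [|k IH] x /=; rewrite ?addn0 // IH /scan /=; lia. Qed.

Lemma foldr_nseq_closing x k j : foldr backscan x (nseq k (closing j)) = x + k.
Proof. by elim: k => [|k IH] /=; rewrite ?addn0 // IH /backscan /=; lia. Qed.

Lemma foldr_nseq_opening x k j : foldr backscan x (nseq k (opening j)) = x - k.
Proof. by elim: k => [|k IH] /=; rewrite ?subn0 // IH /backscan /=; lia. Qed.

Lemma busy_nseq x b k : b.2 -> busy x b (nseq k b) = minn k x.
Proof.
by move=> bc; elim: k x => [|k IH] x /=; rewrite ?min0n // IH /scan bc eqxx /=; lia.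
Qed.

Lemma busy_notin x b s : b \notin s -> busy x b s = 0.
Proof.
elim: s x => [|c s IH] x //=; rewrite inE negb_or eq_sym => /andP[/negbTE-> bs].
by rewrite IH.
Qed.

Lemma backbusy_nseq x b k : ~~ b.2 -> backbusy x b (nseq k b) = minn k x.
Proof.
move=> /negbTE bo.
have fE m : foldr backscan x (nseq m b) = x - m.
  by elim: m => [|m IH] /=; rewrite ?subn0 // IH /backscan bo; lia.
by elim: k => [|k IH] /=; rewrite ?min0n // IH eqxx fE /=; lia.
Qed.

Lemma backbusy_notin x b s : b \notin s -> backbusy x b s = 0.
Proof.
elim: s => [|c s IH] //=; rewrite inE negb_or eq_sym => /andP[/negbTE-> bs].
by rewrite IH.
Qed.

End Scan.

Section BracketWord.
Variable n : nat.
Implicit Types (A B : {mset 'I_n}) (j k : 'I_n) (ks : seq 'I_n).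

Definition block A B k := nseq (B k) (closing k) ++ nseq (A k) (opening k).
Definition blocks A B ks := flatten [seq block A B k | k <- ks].

Lemma bracket_wordE A B : bracket_word A B = blocks A B (enum 'I_n).
Proof. by []. Qed.

Lemma foldl_block A B x k : foldl (@scan n) x (block A B k) = x - B k + A k.
Proof. by rewrite foldl_cat foldl_nseq_closing foldl_nseq_opening. Qed.

Lemma foldr_block A B x k : foldr (@backscan n) x (block A B k) = x - A k + B k.
Proof. by rewrite foldr_cat foldr_nseq_opening foldr_nseq_closing. Qed.

Lemma mem_block A B k (c : bracket n) : c \in block A B k -> c.1 = k.
Proof. by rewrite mem_cat !mem_nseq => /orP[]/andP[_ /eqP->]. Qed.

Lemma busy_block A B x j k :
  busy x (closing j) (block A B k) = if k == j then minn (B k) x else 0.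
Proof.
case: eqP => [<-|kj]; last first.
  by apply: busy_notin; apply/negP => /mem_block /= /esym.
rewrite busy_cat busy_nseq // busy_notin ?addn0 //.
by rewrite mem_nseq negb_and; apply/orP; right; apply/eqP.
Qed.

Lemma backbusy_block A B x j k :
  backbusy x (opening j) (block A B k) = if k == j then minn (A k) x else 0.
Proof.
case: eqP => [<-|kj]; last first.
  by apply: backbusy_notin; apply/negP => /mem_block /= /esym.
rewrite backbusy_cat backbusy_nseq // backbusy_notin ?add0n //.
by rewrite mem_nseq negb_and; apply/orP; right; apply/eqP.
Qed.

Lemma foldl_blocks A B (q : nat -> nat) m ks :
  (forall j, q j.+1 = q j - B j + A j) -> map val ks = iota m (size ks) ->
  foldl (@scan n) (q m) (blocks A B ks) = q (m + size ks).
Proof.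
move=> qS; elim: ks m => [|k ks IH] m /=; first by rewrite addn0.
case=> <- ksE; rewrite foldl_cat foldl_block.
by rewrite -qS IH // addSnnS.
Qed.

Lemma busy_blocks A B (q : nat -> nat) m ks j :
  (forall j, q j.+1 = q j - B j + A j) -> map val ks = iota m (size ks) ->
  busy (q m) (closing j) (blocks A B ks)
    = \sum_(k <- ks | k == j) minn (B k) (q k).
Proof.
move=> qS; elim: ks m => [|k ks IH] m /=; first by rewrite big_nil.
case=> <- ksE; rewrite busy_cat foldl_block busy_block big_cons.
by rewrite -qS IH //; case: eqP.
Qed.

Lemma foldr_blocks A B (q : nat -> nat) m ks :
  (forall j, q j = q j.+1 - A j + B j) -> map val ks = iota m (size ks) ->
  foldr (@backscan n) (q (m + size ks)) (blocks A B ks) = q m.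
Proof.
move=> qS; elim: ks m => [|k ks IH] m /=; first by rewrite addn0.
case=> <- ksE; rewrite foldr_cat.
by rewrite -addSnnS IH // foldr_block -qS.
Qed.

Lemma backbusy_blocks A B (q : nat -> nat) m ks j :
  (forall j, q j = q j.+1 - A j + B j) -> map val ks = iota m (size ks) ->
  backbusy (q (m + size ks)) (opening j) (blocks A B ks)
    = \sum_(k <- ks | k == j) minn (A k) (q k.+1).
Proof.
move=> qS; elim: ks m => [|k ks IH] m /=; first by rewrite big_nil.
case=> <- ksE; rewrite backbusy_cat -addSnnS foldr_blocks // IH //.
by rewrite backbusy_block big_cons; case: eqP.
Qed.

Definition row_size (a : 'I_n -> nat) := \sum_j a j.

Lemma count_blocks A B (P : pred (bracket n)) ks :
  count P (blocks A B ks) =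
    \sum_(k <- ks) (P (closing k) * B k + P (opening k) * A k).
Proof.
elim: ks => [|k ks IH] /=; first by rewrite big_nil.
by rewrite count_cat IH big_cons count_cat !count_nseq.
Qed.

Lemma sum_tnth (P : pred (bracket n)) (w : seq (bracket n)) :
  \sum_(p < size w) P (tnth (in_tuple w) p) = count P w.
Proof.
rewrite -sum1_count [RHS]big_mkcond [RHS](big_tnth _ _ w) /=.
by apply: eq_bigr => p _; case: (P _).
Qed.

Lemma n_opening_word A B : n_opening (bracket_word A B) = row_size A.
Proof.
rewrite /n_opening (sum_tnth (fun c => ~~ c.2)) bracket_wordE count_blocks.
by rewrite big_enum /row_size /=; apply: eq_big => // k _; rewrite mul0n mul1n.
Qed.

Lemma n_closing_word A B : n_closing (bracket_word A B) = row_size B.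
Proof.
rewrite /n_closing (sum_tnth (fun c => c.2)) bracket_wordE count_blocks.
by rewrite big_enum /row_size /=; apply: eq_big => // k _; rewrite mul0n mul1n addn0.
Qed.

Lemma count_opening A B j : count_mem (opening j) (bracket_word A B) = A j.
Proof.
rewrite bracket_wordE count_blocks big_enum /= (bigD1 j) //= big1 => [|k kj].
  by rewrite /opening /closing !xpair_eqE !eqxx andbF mul0n mul1n addn0.
by rewrite /opening /closing !xpair_eqE (negbTE kj).
Qed.

Lemma count_closing A B j : count_mem (closing j) (bracket_word A B) = B j.
Proof.
rewrite bracket_wordE count_blocks big_enum /= (bigD1 j) //= big1 => [|k kj].
  by rewrite /opening /closing !xpair_eqE !eqxx andbF mul0n mul1n !addn0.
by rewrite /opening /closing !xpair_eqE (negbTE kj).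
Qed.

Lemma count_matchedE (w : seq (bracket n)) b :
  count_matched w b =
    \sum_p ((tnth (in_tuple w) p == b) && (p \in matched w)).
Proof.
rewrite /count_matched -sum1_card big_mkcond /=; apply: eq_bigr => p _.
by rewrite inE andbC; case: (_ && _).
Qed.

Lemma count_matched_all (w : seq (bracket n)) b :
  (forall p, tnth (in_tuple w) p = b -> p \in matched w) ->
  count_matched w b = count_mem b w.
Proof.
move=> all; rewrite count_matchedE -(sum_tnth (pred1 b)); apply: eq_bigr => p _ /=.
by case: eqP => // /all ->.
Qed.

(** [Q j] is the number of particles of the lower row [a] still waiting when
    site [j] is reached; closings precede openings within a site, so [b j] of
    them leave before [a j] new ones arrive.  Solutions are not unique when the
    rows have equal sizes; any solution serves below. *)
Definition forward_queue (a b Q : 'I_n -> nat) :=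
  forall j, Q (ordS j) = Q j - b j + a j.

(** [T j] is the number of particles of the upper row [b] available to the
    left of site [j] when the circle is read backwards. *)
Definition backward_queue (a b T : 'I_n -> nat) :=
  forall j, T j = T (ordS j) - a j + b j.

End BracketWord.

Section Unroll.
Variables (n' : nat).
Notation n := n'.+1.

Definition unroll (Q : 'I_n -> nat) (m : nat) := Q (inord (m %% n)).

Lemma unroll_ord Q (j : 'I_n) : unroll Q j = Q j.
Proof. by rewrite /unroll modn_small // inord_val. Qed.

Lemma unrollS Q (j : 'I_n) : unroll Q j.+1 = Q (ordS j).
Proof.
by rewrite /unroll; congr Q; apply: val_inj; rewrite /= inordK // ltn_mod.
Qed.

Lemma unroll_n Q : unroll Q n = unroll Q 0.
Proof. by rewrite /unroll modnn mod0n. Qed.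

End Unroll.

Section Pairing.
Variable n : nat.
Implicit Types (A B : {mset 'I_n}) (j k : 'I_n).

(** The smaller lower row is completely paired, and at each site the upper
    particles that exceed the queue stay unpaired. *)
Lemma forward_pairing A B Q j :
  row_size A <= row_size B -> forward_queue A B Q ->
  paired_lower A B j = A j /\ unpaired_upper A B j = B j - Q j.
Proof.
move=> AB; case: n A B Q j AB => [|n'] A B Q j AB HQ; first by case: j.
pose q := unroll Q.
have qS (k : 'I_n'.+1) : q k.+1 = q k - B k + A k by rewrite /q unrollS unroll_ord HQ.
pose w := bracket_word A B.
have ks : map val (enum 'I_n'.+1) = iota 0 (size (enum 'I_n'.+1)).
  by rewrite val_enum_ord size_enum_ord.
have [opn cls] : (forall p, ~~ (tnth (in_tuple w) p).2 -> p \in matched w) /\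
  (forall p, (tnth (in_tuple w) p).2 ->
     (p \in matched w) = (0 < foldl (@scan _) (q 0) (take p w))).
  apply: (@matched_closing _ w (fun p => foldl (@scan _) (q 0) (take p w))).
  - by rewrite n_opening_word n_closing_word.
  - rewrite take_size take0 /w bracket_wordE foldl_blocks //.
    by rewrite size_enum_ord add0n /q unroll_n.
  - move=> p; rewrite (take_nth (closing j)) // -cats1 foldl_cat /=.
    by rewrite /scan (tnth_nth (closing j)).
split.
  rewrite /paired_lower count_matched_all ?count_opening // => p wp.
  by apply: opn; rewrite wp.
rewrite /unpaired_upper /paired_upper.
suff -> : count_matched w (closing j) = minn (B j) (Q j) by lia.
rewrite count_matchedE.
transitivity (busy (q 0) (closing j) w).
  rewrite busyE; apply: eq_bigr => p _; case: eqP => //= wp.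
  by rewrite cls // wp.
rewrite /w bracket_wordE busy_blocks // big_enum_cond /= big_pred1_eq.
by rewrite /q unroll_ord.
Qed.

Lemma backward_pairing A B T j :
  row_size B <= row_size A -> backward_queue A B T ->
  unpaired_upper A B j = 0 /\ paired_lower A B j = minn (A j) (T (ordS j)).
Proof.
move=> AB; case: n A B T j AB => [|n'] A B T j AB HT; first by case: j.
pose q := unroll T.
have qS (k : 'I_n'.+1) : q k = q k.+1 - A k + B k by rewrite /q unrollS unroll_ord HT.
pose w := bracket_word A B.
have ks : map val (enum 'I_n'.+1) = iota 0 (size (enum 'I_n'.+1)).
  by rewrite val_enum_ord size_enum_ord.
have qn : q (0 + size (enum 'I_n'.+1)) = q 0.
  by rewrite size_enum_ord add0n /q unroll_n.
have [cls opn] : (forall p, (tnth (in_tuple w) p).2 -> p \in matched w) /\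
  (forall p, ~~ (tnth (in_tuple w) p).2 ->
     (p \in matched w) = (0 < foldr (@backscan _) (q 0) (drop p.+1 w))).
  apply: (@matched_opening _ w (fun p => foldr (@backscan _) (q 0) (drop p w))).
  - by rewrite n_opening_word n_closing_word.
  - by rewrite drop_size drop0 /w bracket_wordE -{2}qn foldr_blocks.
  - move=> p; rewrite {1}(drop_nth (closing j)) //=.
    by rewrite {1}/backscan (tnth_nth (closing j)).
split.
  rewrite /unpaired_upper /paired_upper count_matched_all ?count_closing ?subnn //.
  by move=> p wp; apply: cls; rewrite wp.
rewrite /paired_lower count_matchedE.
transitivity (backbusy (q 0) (opening j) w).
  rewrite backbusyE; apply: eq_bigr => p _; case: eqP => //= wp.
  by rewrite opn // wp.
rewrite /w bracket_wordE -qn backbusy_blocks // big_enum_cond /= big_pred1_eq.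
by rewrite /q unrollS.
Qed.

End Pairing.

(** The least [x >= y] with [G x <= x] is a fixed point. *)
Lemma monotone_fixpoint (G : nat -> nat) y X :
  {homo G : a b / a <= b} -> y <= G y -> y <= X -> G X <= X ->
  exists2 x, y <= x & G x = x.
Proof.
move=> Gmono yG yX GX.
have ex : exists x, (y <= x) && (G x <= x) by exists X; rewrite yX.
case: (ex_minnP ex) => x /andP[yx Gx] xmin; exists x => //.
apply/eqP; rewrite eqn_leq Gx xmin // (leq_trans yG (Gmono _ _ yx)) /=.
exact: Gmono.
Qed.

Section CyclicRecursion.
Variables (n : nat) (a b : 'I_n -> nat) (Q0 : 'I_n -> nat).

(** Going once around the circle is a monotone map of the initial length; it
    does not increase a large length, since total arrivals do not exceed total
    services.  Starting from the sub-solution [Q0] yields both the existence of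
    solutions ([Q0 = 0]) and their monotonicity in the data. *)
Lemma cyclic_queue_exists :
  \sum_j a j <= \sum_j b j ->
  (forall j, Q0 (ordS j) <= Q0 j - b j + a j) ->
  exists2 Q : 'I_n -> nat, (forall j, Q0 j <= Q j) &
    forall j, Q (ordS j) = Q j - b j + a j.
Proof.
case: n a b Q0 => [|n'] a' b' Q0' ab sub; first by exists (fun=> 0) => -[].
(* [q x m] is the queue at site m when it has length x at site 0. *)
pose q x := fix q m := if m is m'.+1 then
  q m' - b' (inord m') + a' (inord m') else x.
have qmono m : {homo (q ^~ m) : x y / x <= y}.
  by elim: m => [|m IH] x y xy //=; have := IH x y xy; lia.
have qge x m : unroll Q0' 0 <= x -> m <= n'.+1 -> unroll Q0' m <= q x m.
  move=> x0; elim: m => [|m IH] mn //=.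
  have := IH (ltnW mn); rewrite -[m]/(val (Ordinal mn)) unrollS unroll_ord.
  have := sub (Ordinal mn); rewrite /= (_ : inord m = Ordinal mn); first by lia.
  by apply: val_inj; rewrite /= inordK.
have qlarge x m : m <= n'.+1 -> \sum_j b' j <= x ->
   q x m + \sum_(j < n'.+1 | j < m) b' j = x + \sum_(j < n'.+1 | j < m) a' j.
  move=> + xb; elim: m => [|m IH] mn /=; first by rewrite !big_pred0.
  have {}IH := IH (ltnW mn).
  have one (F : 'I_n'.+1 -> nat) : \sum_(j < n'.+1 | j < m.+1) F j =
      \sum_(j < n'.+1 | j < m) F j + F (inord m).
    rewrite (bigD1 (inord m)) /= ?inordK // addnC; congr (_ + _).
    by apply: eq_bigl => r; rewrite -val_eqE /= inordK //; lia.
  have : \sum_(j < n'.+1 | j < m.+1) b' j <= x.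
    by apply: leq_trans xb; rewrite
      [X in _ <= X](bigID (fun j : 'I_n'.+1 => j < m.+1)) leq_addr.
  move: IH; rewrite !one.
  move: (\sum_(j < n'.+1 | j < m) b' j) (\sum_(j < n'.+1 | j < m) a' j).
  by move: (a' _) (b' _) => *; lia.
have [] := @monotone_fixpoint (q ^~ n'.+1) (unroll Q0' 0)
   (unroll Q0' 0 + \sum_j b' j) (qmono _).
- by rewrite -{1}unroll_n; apply: qge.
- exact: leq_addr.
- have := qlarge (unroll Q0' 0 + \sum_j b' j) n'.+1 (leqnn _) (leq_addl _ _).
  rewrite -!(eq_bigl _ _ (fun j : 'I_n'.+1 => esym (ltn_ord j))).
  by move: ab; move: (\sum_j b' j) (\sum_j a' j) (q _ _) => *; lia.
move=> x x0 qx; exists (fun j => q x j).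
  by move=> j; rewrite -unroll_ord; apply: qge; rewrite // ltnW.
move=> j; rewrite /= (_ : q x j - b' j + a' j = q x j.+1); last first.
  by rewrite /= inord_val.
have [jn|jn] := ltnP j.+1 n'.+1; first by rewrite modn_small.
have -> : j.+1 = n'.+1 by have := ltn_ord j; lia.
by rewrite modnn qx.
Qed.

End CyclicRecursion.

Section QueueExistence.
Variable n : nat.
Implicit Types (A B : {mset 'I_n}).

Lemma forward_queue_exists A B Q0 :
  row_size A <= row_size B ->
  (forall j, Q0 (ordS j) <= Q0 j - B j + A j) ->
  exists2 Q, (forall j, Q0 j <= Q j) & forward_queue A B Q.
Proof. exact: cyclic_queue_exists. Qed.

(** Reflection turns a backward recursion into a forward one. *)
Lemma rev_ord_ordS (j : 'I_n) : ordS (rev_ord (ordS j)) = rev_ord j.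
Proof.
apply: val_inj => /=; have := ltn_ord j.
have [jn|jn] := ltnP j.+1 n => jn'.
  by rewrite (modn_small jn) modn_small; lia.
have -> : j.+1 = n by lia.
rewrite modnn; have -> : (n - 1).+1 = n by lia.
by rewrite modnn; lia.
Qed.

Lemma backward_queue_exists A B T0 :
  row_size B <= row_size A ->
  (forall j, T0 j <= T0 (ordS j) - A j + B j) ->
  exists2 T, (forall j, T0 j <= T j) & backward_queue A B T.
Proof.
move=> BA sub; have rs (F : 'I_n -> nat) : \sum_j F (rev_ord j) = \sum_j F j.
  by rewrite [RHS](reindex_inj rev_ord_inj).
have [||Q Q0Q HQ] := @cyclic_queue_exists n (B \o @rev_ord n) (A \o @rev_ord n)
  (fun j => T0 (ordS (rev_ord j))).
- by rewrite (rs B) (rs A).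
- by move=> j; rewrite rev_ord_ordS; apply: sub.
exists (fun j => Q (ordS (rev_ord j))) => j /=.
  by have := Q0Q (ordS (rev_ord j)); rewrite rev_ord_ordS rev_ordK.
by rewrite HQ /= rev_ordK rev_ord_ordS.
Qed.

End QueueExistence.

(** * Pushing a particle through a pair of rows *)

Section Advance.
Variable n : nat.
Implicit Types (A B : {mset 'I_n}) (i j : 'I_n) (f : 'I_n -> nat).

Definition advance i A := if i \in A then ordS i +` (A `\ i) else A.

(** For [n = 1] the two corrections cancel and nothing changes. *)
Definition slide i f j := if 0 < f i then f j - (j == i) + (j == ordS i) else f j.

Lemma advanceE i A j : advance i A j = slide i A j.
Proof.
rewrite /advance /slide -in_mset; case: ifP => // iA.
by rewrite mset1DE msetB1E addnC.
Qed.

Lemma eq_slide i f f' j : f =1 f' -> slide i f j = slide i f' j.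
Proof. by move=> ff'; rewrite /slide !ff'. Qed.

Lemma slide_fixed i f : ordS i = i -> slide i f =1 f.
Proof. by move=> ii j; rewrite /slide ii; case: eqP => [->|]; case: ifP; lia. Qed.

Lemma sum_slide i f : \sum_j slide i f j = \sum_j f j.
Proof.
have [ii|ii] := eqVneq (ordS i) i.
  by apply: eq_bigr => j _; rewrite slide_fixed.
have ii' : (i == ordS i) = false by rewrite eq_sym (negbTE ii).
rewrite /slide; case: ltnP => // fi.
rewrite (bigD1 i) //= (bigD1 (ordS i)) //= [RHS](bigD1 i) //=
  [in RHS](bigD1 (ordS i)) //=.
rewrite (negbTE ii) ii' !eqxx.
rewrite (eq_bigr f) => [|j /andP[/negbTE-> /negbTE->]]; last by rewrite subn0 addn0.
by move: (\sum_(_ | _) _) => *; lia.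
Qed.

Lemma row_size_advance i A : row_size (advance i A) = row_size A.
Proof.
by rewrite /row_size -[RHS](sum_slide i); apply: eq_bigr => j _; rewrite advanceE.
Qed.

Lemma ordS_eq i j : (ordS i == ordS j) = (i == j).
Proof. by apply/eqP/eqP => [/ordS_inj|->]. Qed.

(** The ringing path: where the upper row rings, given that the lower row [a]
    rings at [i]. *)
Definition next_index (a : 'I_n -> nat) i := if 0 < a i then ordS i else i.

(** In the unrolled word, pushing through the two rows either moves a bracket
    within a block of brackets of one type, or deletes an adjacent pair of
    partners and inserts one a site further on.  Either way the new queue differs
    from the old one at sites [i + 1] and [i + 2] only. *)
Lemma forward_slide (a b Q : 'I_n -> nat) i :
  forward_queue a b Q ->
  exists2 Q', forward_queue (slide i a) (slide (next_index a i) b) Q' &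
    forall j, slide i a j + (slide (next_index a i) b j - Q' j)
      = slide i (fun j => a j + (b j - Q j)) j.
Proof.
move=> HQ; have [ii|ii] := eqVneq (ordS i) i.
  have -> : next_index a i = i by rewrite /next_index ii if_same.
  exists Q => j; rewrite !slide_fixed //; exact: HQ.
have ii' : (i == ordS i) = false by rewrite eq_sym (negbTE ii).
have HQi := HQ i.
rewrite /next_index; have [ai|ai] := posnP (a i).
  (* No particle of a at i: a closing moves across the border of a block of
     closings, so one fewer is met before site i + 1. *)
  exists (fun j => if (j == ordS i) && (0 < b i) then Q i - (b i - 1) else Q j) => j;
    rewrite /slide ?ordS_eq ai /=.
    have := HQ j; case: (eqVneq j i) => [->|ji] /=; rewrite ?ii' /=.
      by case: ltnP; rewrite ?ii' /=; lia.
    by case: (eqVneq j (ordS i)) => [->|_]; case: ltnP => /=; lia.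
  case: (eqVneq j i) => [->|ji] /=; rewrite ?ii' /=.
    by do ?[case: ltnP => ? /=]; lia.
  by case: (eqVneq j (ordS i)) => [->|_]; do ?[case: ltnP => ? /=]; lia.
have [bi|bi] := posnP (b (ordS i)).
  (* An opening moves across the border of a block of openings. *)
  exists (fun j => Q j - (j == ordS i)) => j;
    rewrite /slide ?ordS_eq ?addn_gt0 ai bi /=.
    have := HQ j; case: (eqVneq j i) => [->|ji] /=; rewrite ?ii' /=; first by lia.
    by case: (eqVneq j (ordS i)) => [->|_] /=; lia.
  case: (eqVneq j i) => [->|ji] /=; rewrite ?ii' /=; first by lia.
  by case: (eqVneq j (ordS i)) => [->|_] /=; lia.
(* An adjacent pair of partners moves one site further. *)
exists (fun j => Q j - (j == ordS i) + (j == ordS (ordS i))) => j;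
   rewrite /slide ?ordS_eq ?addn_gt0 ai bi /=.
  have := HQ j; case: (eqVneq j i) => [->|ji] /=; rewrite ?ii' /=; first by lia.
  by case: (eqVneq j (ordS i)) => [->|_] /=; lia.
case: (eqVneq j i) => [->|ji] /=; rewrite ?ii' /=; first by lia.
by case: (eqVneq j (ordS i)) => [->|_] /=; lia.
Qed.

(** The same three cases as in [forward_slide], for the queue read
    backwards. *)
Lemma backward_slide (a b T : 'I_n -> nat) i :
  backward_queue a b T ->
  exists2 T', backward_queue (slide i a) (slide (next_index a i) b) T' &
    forall j, minn (slide i a j) (T' (ordS j))
      = slide i (fun j => minn (a j) (T (ordS j))) j.
Proof.
move=> HT; have [ii|ii] := eqVneq (ordS i) i.
  have -> : next_index a i = i by rewrite /next_index ii if_same.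
  exists T => j; rewrite !slide_fixed //; exact: HT.
have ii' : (i == ordS i) = false by rewrite eq_sym (negbTE ii).
have HTi := HT i; have HTi1 := HT (ordS i).
rewrite /next_index; have [ai|ai] := posnP (a i).
  exists (fun j => T j + ((j == ordS i) && (0 < b i))) => j;
    rewrite /slide ?ordS_eq ai /=.
    have := HT j; case: (eqVneq j i) => [->|ji] /=; rewrite ?ii' /=.
      by case: ltnP; rewrite ?ii' /=; lia.
    by case: (eqVneq j (ordS i)) => [->|_]; case: ltnP => /=; lia.
  by rewrite min0n /=; case: (eqVneq j i) => [->|ji] /=; lia.
have [bi|bi] := posnP (b (ordS i)).
  exists (fun j => T j - (j == ordS i)) => j;
    rewrite /slide ?ordS_eq ai ?bi /=.
    have := HT j; case: (eqVneq j i) => [->|ji] /=; rewrite ?ii' /=; first by lia.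
    by case: (eqVneq j (ordS i)) => [->|_] /=; lia.
  case: (eqVneq j i) => [->|ji] /=; rewrite ?ii' /=; first by case: ifP; lia.
  by case: (eqVneq j (ordS i)) => [->|_] /=; case: ifP; lia.
exists (fun j => T j - (j == ordS i) + (j == ordS (ordS i))) => j;
   rewrite /slide ?ordS_eq ai ?bi /=.
  have := HT j; case: (eqVneq j i) => [->|ji] /=; rewrite ?ii' /=; first by lia.
  by case: (eqVneq j (ordS i)) => [->|_] /=; lia.
case: (eqVneq j i) => [->|ji] /=; rewrite ?ii' /=; first by case: ifP; lia.
by case: (eqVneq j (ordS i)) => [->|_] /=; case: ifP; lia.
Qed.

Lemma forward_queue_exists0 A B : row_size A <= row_size B ->
  exists Q, forward_queue A B Q.
Proof.
by move=> AB; have [//|//|Q _ HQ] := @forward_queue_exists n A B (fun=> 0); exists Q.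
Qed.

Lemma backward_queue_exists0 A B : row_size B <= row_size A ->
  exists T, backward_queue A B T.
Proof.
by move=> AB; have [//|//|Q _ HQ] := @backward_queue_exists n A B (fun=> 0); exists Q.
Qed.

Lemma paired_lower_all A B j : row_size A <= row_size B -> paired_lower A B j = A j.
Proof.
move=> AB; have [Q HQ] := forward_queue_exists0 AB.
by have [-> _] := forward_pairing j AB HQ.
Qed.

Lemma unpaired_upper0 A B j : row_size B <= row_size A -> unpaired_upper A B j = 0.
Proof.
move=> AB; have [Q HQ] := backward_queue_exists0 AB.
by have [-> _] := backward_pairing j AB HQ.
Qed.

(** If the lower row is the smaller one it is completely paired, so only the
    backward queue matters. *)
Lemma paired_lower_advance A B i j :
  paired_lower (advance i A) (advance (next_index A i) B) j
    = slide i (paired_lower A B) j.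
Proof.
have [AB|/ltnW BA] := leqP (row_size A) (row_size B).
  rewrite paired_lower_all ?row_size_advance // advanceE; apply: eq_slide => k.
  by rewrite paired_lower_all.
have [T HT] := backward_queue_exists0 BA; have [T' HT' T'E] := backward_slide i HT.
have {}HT' : backward_queue (advance i A) (advance (next_index A i) B) T'.
  by move=> k; rewrite !advanceE; apply: HT'.
have [|_ ->] := backward_pairing j _ HT'; first by rewrite !row_size_advance.
rewrite advanceE T'E; apply: eq_slide => k.
by have [_ ->] := backward_pairing k BA HT.
Qed.

(** If the upper row is the smaller one nothing of it is unpaired, so only the
    forward queue matters. *)
Lemma lower_with_unpaired_advance A B i j :
  advance i A j + unpaired_upper (advance i A) (advance (next_index A i) B) j
    = slide i (fun k => A k + unpaired_upper A B k) j.
Proof.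
have [BA|/ltnW AB] := leqP (row_size B) (row_size A).
  rewrite unpaired_upper0 ?row_size_advance // addn0 advanceE.
  by apply: eq_slide => k; rewrite unpaired_upper0 // addn0.
have [Q HQ] := forward_queue_exists0 AB; have [Q' HQ' Q'E] := forward_slide i HQ.
have {}HQ' : forward_queue (advance i A) (advance (next_index A i) B) Q'.
  by move=> k; rewrite !advanceE; apply: HQ'.
have [|_ ->] := forward_pairing j _ HQ'; first by rewrite !row_size_advance.
rewrite !advanceE Q'E; apply: eq_slide => k.
by have [_ ->] := forward_pairing k AB HQ.
Qed.

Lemma row_size_le A B : (forall j, A j <= B j) -> row_size A <= row_size B.
Proof. by move=> AB; apply: leq_sum. Qed.

Lemma paired_lower_le A B j : paired_lower A B j <= A j.
Proof.
rewrite /paired_lower count_matchedE.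
rewrite -[leqRHS](count_opening A B) -(sum_tnth (pred1 _)).
by apply: leq_sum => p _ /=; case: (_ == _) => //=; case: (_ \in _).
Qed.

(** More services only pair more particles: a solution for [B'] is a
    sub-solution for [B]. *)
Lemma paired_lower_mono A B B' j : (forall k, B' k <= B k) ->
  paired_lower A B' j <= paired_lower A B j.
Proof.
move=> B'B; have sB := row_size_le B'B.
have [AB|/ltnW BA] := leqP (row_size A) (row_size B).
  by rewrite (paired_lower_all _ AB) paired_lower_le.
have B'A := leq_trans sB BA.
have [T' HT'] := backward_queue_exists0 B'A.
have [|T T'T HT] := @backward_queue_exists n A B T' BA.
  by move=> k; rewrite HT' leq_add2l.
have [_ ->] := backward_pairing j BA HT; have [_ ->] := backward_pairing j B'A HT'.
by rewrite leq_min geq_minl /= (leq_trans (geq_minr _ _)).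
Qed.

(** A solution for the larger row [B] is a sub-solution for [B'], so the queue
    met by [B'] may be taken longer. *)
Lemma unpaired_upper_mono A B B' j : (forall k, B' k <= B k) ->
  unpaired_upper A B' j <= unpaired_upper A B j.
Proof.
move=> B'B; have sB := row_size_le B'B.
have [B'A|/ltnW AB'] := leqP (row_size B') (row_size A).
  by rewrite unpaired_upper0.
have AB := leq_trans AB' sB.
have [Q HQ] := forward_queue_exists0 AB.
have [|Q' QQ' HQ'] := @forward_queue_exists n A B' Q AB'.
  by move=> k; rewrite HQ leq_add2r leq_sub2l.
have [_ ->] := forward_pairing j AB HQ; have [_ ->] := forward_pairing j AB' HQ'.
exact: leq_sub.
Qed.

End Advance.

(** * Words as nested rows, and the row operator on them *)

Section MultisetCounts.
Variable T : choiceType.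
Implicit Types (A : {mset T}) (P : pred T).

Lemma mem_enum_mset a A : (a \in enum_mset A) = (a \in A).
Proof. by []. Qed.

Lemma count_mset1D P y A :
  count P (enum_mset (y +` A)) = P y + count P (enum_mset A).
Proof.
suff /permP -> : perm_eq (enum_mset (y +` A)) (y :: enum_mset A) by [].
apply/eq_seq_msetP/msetP => z; rewrite !mset_seqE /= !count_mem_mset.
by rewrite mset1DE eq_sym.
Qed.

Lemma count_msetB1 P y A : y \in A ->
  count P (enum_mset A) = P y + count P (enum_mset (A `\ y)).
Proof. by move=> yA; rewrite -count_mset1D msetB1K. Qed.

Lemma count_seq_mset P s : count P (enum_mset (seq_mset s)) = count P s.
Proof. by apply/permP; apply: perm_eq_seq_mset. Qed.

End MultisetCounts.

Lemma count_flatten_nseq (I T : Type) (P : pred T) (f : I -> nat) (g : I -> T) s :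
  count P (flatten [seq nseq (f i) (g i) | i <- s]) = \sum_(i <- s) P (g i) * f i.
Proof.
elim: s => [|i s IH] /=; first by rewrite big_nil.
by rewrite count_cat count_nseq IH big_cons.
Qed.

Lemma mset_nat_eq (A B : {mset nat}) :
  (forall r, count (leq r) (enum_mset A) = count (leq r) (enum_mset B)) -> A = B.
Proof.
move=> AB; apply/msetP => y.
have split (C : {mset nat}) :
    count (leq y) (enum_mset C) = C y + count (leq y.+1) (enum_mset C).
  rewrite -count_mem_mset; elim: (enum_mset C : seq nat) => //= z s ->.
  by case: (ltngtP y z) => //= *; lia.
by have := AB y; rewrite !split AB => /addIn.
Qed.

Lemma row_sizeE n (A : {mset 'I_n}) : size (enum_mset A) = row_size A.
Proof.
rewrite /row_size; under eq_bigr do rewrite -count_mem_mset.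
elim: (enum_mset A : seq 'I_n) => [|i s IH] /=; first by rewrite big1.
rewrite big_split /= -IH (bigD1 i) //= eqxx big1 // => j /negbTE.
by rewrite eq_sym => ->.
Qed.

Lemma letter_max_in (A : {mset nat}) : A != mset0 -> letter_max A \in A.
Proof.
move=> A0; rewrite -mem_enum_mset /letter_max.
have : (enum_mset A : seq nat) != [::].
  apply: contraNneq A0 => A0; apply/eqP/msetP => y.
  by rewrite mset0E -count_mem_mset A0.
elim: (enum_mset A : seq nat) => // y s IH _.
rewrite big_cons inE; have [->|s0] := eqVneq s [::].
  by rewrite big_nil maxn0 eqxx.
by case: (leqP y (\max_(z <- s) z)) => _; rewrite ?eqxx ?IH ?orbT.
Qed.

Section Words.
Variable n : nat.
Implicit Types (w u : word n) (A B D : {mset 'I_n}) (i j : 'I_n).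

Definition profile w r j := count (leq r) (enum_mset (tnth w j)).

Lemma word_eq w w' : (forall r j, profile w r j = profile w' r j) -> w = w'.
Proof.
by move=> ww'; apply: eq_from_tnth => j; apply: mset_nat_eq => r; apply: ww'.
Qed.

Lemma profile_empty r j : profile (empty_word n) r j = 0.
Proof. by rewrite /profile /empty_word tnth_mktuple enum_mset0. Qed.

Lemma levelE u r j : level u r j = profile u r j.
Proof.
rewrite mset_seqE count_flatten_nseq big_enum /= (bigD1 j) //= eqxx mul1n.
by rewrite big1 ?addn0 // => k /negbTE ->.
Qed.

(** The transition of the zero-range process attached to site [i], extended by
    the identity to an empty site so that it is total. *)
Definition hop_or_stay w i := if tnth w i == mset0 then w else hop w i.

(** A nonempty site [i] meets level [r] exactly when its largest letter is at
    least [r]. *)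
Lemma profile_hop w i r j :
  profile (hop_or_stay w i) r j = slide i (profile w r) j.
Proof.
rewrite /hop_or_stay /slide.
have -> : (0 < profile w r i) =
   (tnth w i != mset0) && (r <= letter_max (tnth w i)).
  rewrite /profile -has_count; have [->|wi] /= := eqVneq.
    by rewrite enum_mset0.
  apply/hasP/idP => [[y yw ry]|rm].
    apply: (leq_trans ry); exact: (@leq_bigmax_seq _ _ predT id).
  by exists (letter_max (tnth w i)) => //; rewrite mem_enum_mset; apply: letter_max_in.
case: eqVneq => //= wi.
have yw := letter_max_in wi.
rewrite /profile /hop tnth_mktuple; set y := letter_max _ in yw *.
have wB : count (leq r) (enum_mset (if j == i then tnth w j `\ y else tnth w j)) =
   count (leq r) (enum_mset (tnth w j)) - ((j == i) && (r <= y)).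
  case: eqP => [->|_] /=; last by rewrite subn0.
  by rewrite [in RHS](count_msetB1 _ yw) addnC addnK.
case: ifP => ji1; rewrite ?count_mset1D wB ?ji1.
  by case: (leqP r y); case: (j == i); lia.
by case: (leqP r y); case: (j == i); lia.
Qed.

Lemma level_hop w i r : level (hop_or_stay w i) r = advance i (level w r).
Proof.
apply/msetP => j; rewrite levelE profile_hop advanceE.
by rewrite /slide !levelE.
Qed.

Lemma mem_letters w y : reflect (exists j, y \in tnth w j) (y \in letters w).
Proof.
apply: (iffP flatten_mapP) => [[A /tnthP[j ->]]|[j yj]].
  by rewrite mem_enum_mset; exists j.
by exists (tnth w j); rewrite ?mem_tnth ?mem_enum_mset.
Qed.

Lemma count_letters (P : pred nat) w :
  count P (letters w) = \sum_j count P (enum_mset (tnth w j)).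
Proof.
rewrite /letters count_flatten -map_comp sumnE big_map.
by rewrite big_tuple; apply: eq_bigr => j _.
Qed.

Lemma letters_le_max u y : y \in letters u -> y <= word_max u.
Proof. by move=> yu; apply: (@leq_bigmax_seq _ _ predT id). Qed.

Lemma word_min_le u y : y \in letters u -> word_min u <= y.
Proof.
rewrite /word_min; elim: (letters u) (word_max u) => // z s IH x.
rewrite inE big_cons => /orP[/eqP->|/IH H]; first exact: geq_minl.
exact: leq_trans (geq_minr _ _) (H x).
Qed.

Lemma lt_word_min l u : u != empty_word n -> all (ltn l) (letters u) -> l < word_min u.
Proof.
move=> u0 /allP lu.
have lM : l < word_max u.
  have : has predT (letters u).
    apply: contraR u0; rewrite has_predT -leqNgt leqn0 size_eq0 => /eqP u0.
    apply/eqP/word_eq => r j; rewrite profile_empty; apply/eqP.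
    rewrite -leqn0 leqNgt -has_count; apply/hasP => -[y].
    rewrite mem_enum_mset => yj _.
    have : y \in letters u by apply/mem_letters; exists j.
    by rewrite u0.
  by case/hasP => y yu _; apply: leq_trans (lu _ yu) (letters_le_max yu).
rewrite /word_min big_seq; apply: (big_ind (fun x => l < x)) => [//|x y lx ly|y /lu //].
by rewrite leq_min lx.
Qed.

Lemma word_min_le_max u : word_min u <= word_max u.
Proof.
rewrite /word_min; elim: (letters u) (word_max u) => [|z s IH] x.
  by rewrite big_nil.
by rewrite big_cons (leq_trans (geq_minr _ _)).
Qed.

Lemma profile_min u r j : r <= word_min u -> profile u r j = profile u (word_min u) j.
Proof.
move=> rm; apply: eq_in_count => y; rewrite mem_enum_mset => yj.
have /word_min_le H : y \in letters u by apply/mem_letters; exists j.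
by rewrite H (leq_trans rm).
Qed.

Lemma profile_max u r j : word_max u < r -> profile u r j = 0.
Proof.
move=> rm; apply/eqP; rewrite -leqn0 leqNgt -has_count; apply/hasP => -[y].
rewrite mem_enum_mset => yj.
have /letters_le_max H : y \in letters u by apply/mem_letters; exists j.
by rewrite leqNgt (leq_ltn_trans H rm).
Qed.

Lemma profile_anti u r r' j : r <= r' -> profile u r' j <= profile u r j.
Proof. by move=> rr'; apply: sub_count => y /=; apply: leq_trans. Qed.

Lemma level_anti u r r' j : r <= r' -> level u r' j <= level u r j.
Proof. by rewrite !levelE; apply: profile_anti. Qed.

Lemma level_min u r : r <= word_min u -> level u r = level u (word_min u).
Proof. by move=> rm; apply/msetP => j; rewrite !levelE profile_min. Qed.

Lemma level_max u r : word_max u < r -> level u r = mset0.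
Proof. by move=> rm; apply/msetP => j; rewrite levelE profile_max ?mset0E. Qed.

Lemma last_filter_iota (P : pred nat) x m k (s := last x [seq r <- iota m k | P r]) :
  ((s = x) \/ (P s /\ m <= s < m + k)) /\
  (forall r, m <= r < m + k -> P r -> r <= s).
Proof.
rewrite {}/s; elim: k => [|k [IH1 IH2]]; first by split; [left|move=> r; lia].
rewrite -addn1 iotaD filter_cat /= last_cat /=.
case: ifP => Pk /=; first by split=> [|r]; [right; split=> //; lia|lia].
split; first by case: IH1 => [->|[? ?]]; [left|right; split=> //; lia].
move=> r rmk Pr; apply: IH2 => //.
have : r != m + k by apply: contraTneq Pr => ->; rewrite Pk.
by lia.
Qed.

(** All that is needed about the threshold between the two phases: the next
    level has at most as many particles as [D], and the level itself has at
    least as many unless it is the lowest one. *)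
Lemma pairing_boundP D u (s := pairing_bound D u) :
  [/\ word_min u <= s <= word_max u,
      (s == word_min u) || (row_size D <= row_size (level u s)) &
      row_size (level u s.+1) <= row_size D].
Proof.
have aK := word_min_le_max u.
have [sE smax] := last_filter_iota
  (fun r => size (enum_mset D) <= size (enum_mset (level u r)))
  (word_min u) (word_min u) ((word_max u).+1 - word_min u).
rewrite -/(index_iota _ _) -/(pairing_bound D u) -/s in sE smax.
have sK : word_min u <= s <= word_max u by case: sE => [->|[_]]; lia.
split=> //.
  by case: sE => [->|[+ _]]; rewrite ?eqxx // -!row_sizeE => ->; rewrite orbT.
have [sK'|sK'] := ltnP (word_max u) s.+1.
  by rewrite level_max // /row_size big1 // => j _; rewrite mset0E.
rewrite leqNgt; apply/negP => /ltnW; rewrite -!row_sizeE => /smax; lia.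
Qed.

Lemma telescope (p : nat -> nat) m k : {homo p : x y / x <= y >-> y <= x} ->
  m <= k -> \sum_(m <= i < k) (p i - p i.+1) = p m - p k.
Proof.
move=> pm mk; elim: k mk => [|k IH] mk.
  by rewrite big_geq //; have -> : m = 0; lia.
have [mk'|mk'] := leqP m k; last first.
  by have -> : m = k.+1; [lia|rewrite big_geq // subnn].
rewrite big_nat_recr //= IH //; have := pm m k mk'; have := pm k k.+1 (leqnSn k).
lia.
Qed.

Lemma telescope_from (p : nat -> nat) r m k :
  {homo p : x y / x <= y >-> y <= x} -> p k = 0 ->
  \sum_(m <= i < k) (r <= i) * (p i - p i.+1) = p (maxn m r).
Proof.
move=> pm pk.
have [mk|mk] := leqP (maxn m r) k; last first.
  rewrite big_nat_cond big1 => [|i]; last first.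
    by move=> H; have -> : (r <= i) = false by lia.
  by apply/esym/eqP; rewrite -leqn0 -pk pm // ltnW.
rewrite (big_cat_nat (n := maxn m r)) ?leq_maxl //=.
rewrite big_nat_cond big1 ?add0n; last by move=> i H; have -> : (r <= i) = false by lia.
have := telescope pm mk; rewrite pk subn0 => <-.
rewrite big_nat_cond [RHS]big_nat_cond.
apply: eq_bigr => i H; have -> : (r <= i) by lia.
by rewrite mul1n.
Qed.

Lemma paired_lower_empty A j : paired_lower A mset0 j = 0.
Proof.
have e0 : row_size (mset0 : {mset 'I_n}) = 0.
  by rewrite /row_size big1 // => k _; rewrite mset0E.
have [||_ ->] := @backward_pairing _ A mset0 (fun=> 0) j; last exact: minn0.
  by rewrite e0.
by move=> k; rewrite mset0E.
Qed.

Lemma unpaired_upper_empty A j : unpaired_upper A mset0 j = 0.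
Proof. by rewrite /unpaired_upper mset0E. Qed.

(** The letters of both phases are differences of consecutive levels, so
    counting those that are at least [r] telescopes.  The threshold disappears
    from the result: above it nothing in the upper row is unpaired, and below it
    all of [D] is paired. *)
Lemma profile_row_op l D u r j : all (ltn l) (letters u) ->
  profile (row_op l D u) r j =
    (if l < r then paired_lower D (level u r) j else D j)
      + unpaired_upper D (level u (maxn l r).+1) j.
Proof.
rewrite /row_op /profile; case: eqVneq => [-> _|u0 lu]; rewrite tnth_mktuple.
  have lev r' : level (empty_word n) r' = mset0.
    by apply/msetP => k; rewrite levelE profile_empty mset0E.
  rewrite !lev paired_lower_empty unpaired_upper_empty enum_msetn count_nseq.
  by case: leqP; rewrite ?mul1n ?addn0.
have la := lt_word_min u0 lu.
rewrite /row_op_letter count_seq_mset; set s := pairing_bound D u.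
have [/andP[a_s sK] sP sM] := pairing_boundP D u; rewrite -/s in a_s sK sP sM.
rewrite !count_cat !count_flatten_nseq count_nseq.
pose p r := paired_lower D (level u r) j.
pose v r := unpaired_upper D (level u r) j.
have p_anti : {homo p : x y / x <= y >-> y <= x}.
  by move=> x y xy; apply: paired_lower_mono => k; apply: level_anti.
have v_anti : {homo v : x y / x <= y >-> y <= x}.
  by move=> x y xy; apply: unpaired_upper_mono => k; apply: level_anti.
have -> : \sum_(i <- index_iota s (word_max u).+1) (r <= i) * newly_paired D u i j
    = p (maxn s r).
  apply: (telescope_from (p := p)) => //.
  by rewrite /p level_max // paired_lower_empty.
have vs : v s.+1 = 0 by apply: unpaired_upper0.
have vmin x : x <= word_min u -> v x = v (word_min u).
  by move=> /level_min; rewrite /v => ->.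
have pmin x : x <= word_min u -> p x = p (word_min u).
  by move=> /level_min; rewrite /p => ->.
have -> : \sum_(i <- index_iota (word_min u) s.+1) (r <= i.-1) * newly_unpaired D u i j
    = v (maxn (word_min u) r.+1).
  rewrite -(@telescope_from v r.+1 (word_min u) s.+1) //.
  rewrite big_nat_cond [RHS]big_nat_cond; apply: eq_bigr => i H.
  by congr (nat_of_bool _ * _); lia.
rewrite -/(v (maxn l r).+1) -/(p r) /unpaired_lower -/(p s).
have -> : v (maxn (word_min u) r.+1) = v (maxn l r).+1.
  have [ra|ra] := leqP r.+1 (word_min u); first by rewrite (vmin (maxn l r).+1) //; lia.
  by congr v; lia.
have ps : p s <= D j by apply: paired_lower_le.
have [lr|rl] := ltnP l r.
  rewrite mul0n add0n; congr (_ + _).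
  have [//|rs] := leqP s r.
  case/orP: sP => [/eqP sa|sD].
    by rewrite sa (pmin r) //; lia.
  rewrite /p !paired_lower_all // (leq_trans sD) //; apply: row_size_le => k.
  by apply: level_anti; apply: ltnW.
rewrite mul1n addnA; congr (_ + _).
by have -> : maxn s r = s; lia.
Qed.

End Words.

(** * Ringing paths and hops *)

Section Commutation.
Variable n : nat.
Implicit Types (w u : word n) (A B D : {mset 'I_n}) (i j : 'I_n).
Implicit Types (s : seq (queue_row n)).

Lemma letters_hop w i y : y \in letters (hop_or_stay w i) -> y \in letters w.
Proof.
case/mem_letters => j; rewrite /hop_or_stay; case: eqVneq => [_ yj|wi].
  by apply/mem_letters; exists j.
rewrite tnth_mktuple /=; set A := if j == i then _ else _.
have sub : y \in A -> y \in tnth w j.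
  by rewrite /A; case: ifP => // _; rewrite in_msetB1 => /andP[].
case: ifP => _ yj; apply/mem_letters; last by exists j; apply: sub.
move: yj; rewrite in_mset1D => /orP[/eqP->|/sub ?]; last by exists j.
by exists i; apply: letter_max_in.
Qed.

(** At each level one of the two summands of [profile_row_op] is trivial, and
    the other is covered by one of the two statements on pushing a particle
    through a pair of rows. *)
Lemma row_op_hop l D u i : all (ltn l) (letters u) ->
  row_op l (advance i D) (hop_or_stay u (next_index D i))
    = hop_or_stay (row_op l D u) i.
Proof.
move=> lu; apply: word_eq => r j; rewrite profile_hop profile_row_op; last first.
  by apply/allP => y /letters_hop; apply: (allP lu).
rewrite !level_hop; set B := level u r; set B' := level u _.
transitivity (slide i (fun k => (if l < r then paired_lower D B k else D k)
                               + unpaired_upper D B' k) j); last first.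
  by apply: eq_slide => k; rewrite profile_row_op.
case: ltnP => lr; last exact: lower_with_unpaired_advance.
have [B'D|/ltnW DB'] := leqP (row_size B') (row_size D).
  rewrite unpaired_upper0 ?row_size_advance // addn0 paired_lower_advance.
  by apply: eq_slide => k; rewrite unpaired_upper0 // addn0.
have DB : row_size D <= row_size B.
  apply: (leq_trans DB'); apply: row_size_le => k; apply: level_anti; lia.
rewrite paired_lower_all ?row_size_advance // lower_with_unpaired_advance.
by apply: eq_slide => k; rewrite paired_lower_all.
Qed.

(** A variable lowest index allows recursion on the rows. *)
Definition Phi_from l s : word n :=
  foldr (fun lD u => row_op lD.1 lD.2 u) (empty_word n) (zip (iota l (size s)) s).

Lemma Phi_fromE L (D : L.-tuple (queue_row n)) : Phi D = Phi_from 1 D.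
Proof. by rewrite /Phi /Phi_from size_tuple. Qed.

Lemma all_letters l w : (forall j, profile w 0 j = profile w l j) ->
  all (leq l) (letters w).
Proof.
move=> wl; apply/allP => y /mem_letters[j yj].
have : all (leq l) (enum_mset (tnth w j)).
  by rewrite all_count -[_ == _]/(profile w l j == _) -wl /profile count_predT.
by move/allP; apply.
Qed.

Lemma Phi_from_letters l s : all (leq l) (letters (Phi_from l s)).
Proof.
elim: s l => [|A s IH] l; apply: all_letters => j.
  by rewrite !profile_empty.
by rewrite !profile_row_op ?IH // ltn0 ltnn !maxn0 ?maxnn.
Qed.

(** [ring_step] by recursion on the rows, to match the recursion of
    [Phi_from]. *)
Fixpoint ring_rows i s : seq (queue_row n) :=
  if s is A :: s' then advance i A :: ring_rows (next_index A i) s' else [::].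

Lemma Phi_from_ring l s i :
  Phi_from l (ring_rows i s) = hop_or_stay (Phi_from l s) i.
Proof.
elim: s l i => [|A s IH] l i.
  by rewrite /hop_or_stay /Phi_from /= tnth_mktuple eqxx.
rewrite [LHS](_ : _ = row_op l (advance i A)
   (Phi_from l.+1 (ring_rows (next_index A i) s))) //.
by rewrite IH row_op_hop // Phi_from_letters.
Qed.

Lemma ringing_path_cons L A (D : L.-tuple (queue_row n)) i k :
  ringing_path (cons_tuple A D) i k.+1 = ringing_path D (next_index A i) k.
Proof.
elim: k => [|k IH]; first by rewrite /= in_mset.
by rewrite -[LHS]/(let a := ringing_path (cons_tuple A D) i k.+1 in
  if a \in nth mset0 D k then ordS a else a) IH.
Qed.

Lemma ring_stepE L (D : L.-tuple (queue_row n)) i :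
  ring_step D i = ring_rows i D :> seq _.
Proof.
elim: L D i => [|L IH] D i; first by rewrite [ring_step _ _]tuple0 [D]tuple0.
case/tupleP: D => A D /=.
rewrite -IH; apply: (congr1 val
  (x := ring_step (cons_tuple A D) i) (y := cons_tuple _ _)).
apply: eq_from_tnth => k; rewrite tnth_mktuple.
case: (unliftP ord0 k) => [k'|] ->; last by rewrite !tnth0.
rewrite !tnthS tnth_mktuple.
by rewrite -[val (lift _ _)]/(k'.+1) ringing_path_cons.
Qed.

Lemma Phi_ring_step L (D : L.-tuple (queue_row n)) i :
  Phi (ring_step D i) = hop_or_stay (Phi D) i.
Proof. by rewrite !Phi_fromE ring_stepE Phi_from_ring. Qed.

(** Every particle of an image row comes from a particle of [D] or of [u] at
    the same site. *)
Lemma Phi_from_nonempty l s i :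
  tnth (Phi_from l s) i != mset0 -> has (fun A => i \in A) s.
Proof.
have neE w : (tnth w i != mset0) = (0 < profile w 0 i).
  rewrite /profile -has_count; apply/idP/hasP => [wi|[y + _]].
    by exists (letter_max (tnth w i)); rewrite ?mem_enum_mset ?letter_max_in.
  by rewrite mem_enum_mset; apply: contraTneq => ->; rewrite in_mset0.
elim: s l => [|A s IH] l; first by rewrite neE profile_empty.
rewrite neE profile_row_op ?Phi_from_letters // ltn0 /= addn_gt0.
case/orP => [|H]; first by rewrite -in_mset => ->.
rewrite (IH l.+1) ?orbT // neE; apply: leq_trans H _.
rewrite /unpaired_upper (leq_trans (leq_subr _ _)) // levelE.
exact: profile_anti.
Qed.

Lemma Phi_nonempty L (D : L.-tuple (queue_row n)) i :
  tnth (Phi D) i != mset0 -> column_nonempty D i.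
Proof.
rewrite Phi_fromE => /Phi_from_nonempty/hasP[A /tnthP[k ->] iA].
by apply/existsP; exists k.
Qed.

Lemma ring_step_type L (alpha : L.-tuple nat) (D : L.-tuple (queue_row n)) i :
  bMLQ alpha D -> bMLQ alpha (ring_step D i).
Proof.
move=> Dalpha k; rewrite -Dalpha tnth_mktuple /= !row_sizeE.
by rewrite -[RHS](row_size_advance (ringing_path D i k)).
Qed.

End Commutation.

(** * The type of the image *)

Section Sizes.
Variable n : nat.
Implicit Types (A B D : {mset 'I_n}) (u w : word n).

Lemma sum_ordS (f : 'I_n -> nat) : \sum_j f (ordS j) = \sum_j f j.
Proof. by rewrite [RHS](reindex_inj (@ordS_inj n)). Qed.

(** Summing a queue recursion over the circle cancels the queue lengths. *)
Lemma sum_paired_lower A B :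
  \sum_j paired_lower A B j = minn (row_size A) (row_size B).
Proof.
have [AB|/ltnW BA] := leqP (row_size A) (row_size B).
  by rewrite /row_size; apply: eq_bigr => j _; rewrite paired_lower_all.
have [T HT] := backward_queue_exists0 BA.
have /eqP : \sum_j (T j + paired_lower A B j) = \sum_j (T (ordS j) + B j).
  apply: eq_bigr => j _; have [_ ->] := backward_pairing j BA HT.
  have := HT j; move: (T j) (T (ordS j)) (A j : nat) (B j : nat) => *; lia.
by rewrite !big_split /= sum_ordS eqn_add2l => /eqP.
Qed.

Lemma sum_unpaired_upper A B :
  \sum_j unpaired_upper A B j = row_size B - row_size A.
Proof.
have [BA|/ltnW AB] := leqP (row_size B) (row_size A).
  by rewrite (eqP BA) big1 // => j _; rewrite unpaired_upper0.
have [Q HQ] := forward_queue_exists0 AB.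
have : \sum_j (Q j + A j + unpaired_upper A B j) = \sum_j (Q (ordS j) + B j).
  apply: eq_bigr => j _; have [_ ->] := forward_pairing j AB HQ.
  have := HQ j; move: (Q j) (Q (ordS j)) (A j : nat) (B j : nat) => *; lia.
rewrite !big_split /= sum_ordS -/(row_size A) -/(row_size B).
by move: (row_size A) (row_size B) (\sum_j Q j) => *; lia.
Qed.

Lemma count_lettersE w r : count (leq r) (letters w) = \sum_j profile w r j.
Proof. exact: count_letters. Qed.

Lemma row_size_level u r : row_size (level u r) = count (leq r) (letters u).
Proof.
by rewrite count_lettersE /row_size; apply: eq_bigr => j _; rewrite levelE.
Qed.

Lemma count_letters_row_op l D u r : all (ltn l) (letters u) ->
  count (leq r) (letters (row_op l D u)) =
    (if l < r then minn (row_size D) (count (leq r) (letters u)) else row_size D)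
     + (count (leq (maxn l r).+1) (letters u) - row_size D).
Proof.
move=> lu; rewrite count_lettersE.
under eq_bigr do rewrite profile_row_op //.
rewrite big_split /= sum_unpaired_upper row_size_level; congr (_ + _).
by case: ltnP => // _; rewrite sum_paired_lower row_size_level.
Qed.

End Sizes.

Section DecreasingInsertion.
Implicit Types (t s : seq nat) (d : nat).

Fixpoint insert_desc d t :=
  if t is x :: t' then if x <= d then d :: t else x :: insert_desc d t' else [:: d].

Definition sort_desc s := foldr insert_desc [::] s.

Lemma perm_insert_desc d t : perm_eq (insert_desc d t) (d :: t).
Proof.
elim: t => //= x t IH; case: ifP => // _.
rewrite -(perm_cons x) in IH; apply: (perm_trans IH).
by apply/permPl; apply: (perm_catCA [:: x] [:: d] t).
Qed.

Lemma perm_sort_desc s : perm_eq (sort_desc s) s.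
Proof.
elim: s => //= d s IH; rewrite (perm_trans (perm_insert_desc _ _)) //.
by rewrite perm_cons.
Qed.

Lemma insert_desc_sorted d t : sorted geq t -> sorted geq (insert_desc d t).
Proof.
case: t => //= x t xt; case: leqP => [xd|dx]; first by rewrite /= xd.
elim: t x dx xt => [|y t IH] x dx /=; first by rewrite (ltnW dx).
case/andP => yx yt; case: leqP => [yd|dy] /=; first by rewrite yd (ltnW dx).
by rewrite yx; apply: IH.
Qed.

Lemma sort_desc_sorted s : sorted geq (sort_desc s).
Proof. by elim: s => //= d s IH; apply: insert_desc_sorted. Qed.

Lemma nth_desc t k : sorted geq t -> nth 0 t k.+1 <= nth 0 t k.
Proof.
elim: t k => [|x t IH] [|k] //= xt; last by apply: IH; apply: path_sorted xt.
by case: t xt {IH} => //= y t /andP[].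
Qed.

Lemma nth_le_head t k : sorted geq t -> nth 0 t k <= head 0 t.
Proof.
by move=> ts; rewrite -nth0; elim: k => // k; apply: leq_trans; apply: nth_desc.
Qed.

(** The right-hand side is the size of level [k] after adding a row with [d]
    particles to levels of sizes [t], as read off from [profile_row_op]. *)
Lemma nth_insert_desc d t k : sorted geq t ->
  nth 0 (insert_desc d t) k =
    (if k is k'.+1 then minn d (nth 0 t k') else d) + (nth 0 t k - d).
Proof.
elim: t k => [|x t IH] k xt /=; first by case: k => [|[|k]] //=; lia.
have st := path_sorted xt.
case: leqP => xd; last first.
  case: k => [|k] /=; first by lia.
  rewrite (IH k st); case: k => [|k] /=; last by [].
  by congr (_ + _); lia.
have small m : nth 0 (x :: t) m <= d by exact: leq_trans (@nth_le_head (x :: t) m xt) xd.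
case: k => [|k] /=; first by lia.
have := small k; have := small k.+1 => /= s1 s2.
by case: k s1 s2 => [|k] /= *; lia.
Qed.

Lemma filter_pos_nth t k : sorted geq t ->
  nth 0 t k = nth 0 [seq p <- t | 0 < p] k.
Proof.
elim: t k => //= x t IH k xt; have st := path_sorted xt.
case: posnP => [x0|xp]; last by case: k => //= k; apply: IH.
rewrite -IH //.
have all0 m : nth 0 (x :: t) m = 0.
  by apply/eqP; rewrite -leqn0 -[X in _ <= X]x0; apply: (@nth_le_head (x :: t) m xt).
by have /= -> := all0 k.+1; rewrite all0.
Qed.

Lemma geq_anti : antisymmetric geq.
Proof. by move=> x y; rewrite andbC => /anti_leq. Qed.

Lemma geq_trans : transitive geq.
Proof. by move=> y x z xy yz; apply: leq_trans yz xy. Qed.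

Lemma nth_sort_desc s la k : sorted geq la -> rearranges_to s la ->
  nth 0 (sort_desc s) k = nth 0 la k.
Proof.
move=> sla perm; rewrite filter_pos_nth ?sort_desc_sorted // [RHS]filter_pos_nth //.
congr nth; apply: (sorted_eq geq_trans geq_anti).
- by apply: sorted_filter; [exact: geq_trans|exact: sort_desc_sorted].
- by apply: sorted_filter; first exact: geq_trans.
- by apply: perm_trans perm; apply: perm_filter; apply: perm_sort_desc.
Qed.

(** The two sides say that the box [(r, i)] belongs to the Young diagram. *)
Lemma leq_count_desc la i r : sorted geq la ->
  (r < count (fun p => i < p) la) = (i < nth 0 la r).
Proof.
elim: la r => [|x t IH] r xt /=; first by rewrite nth_nil.
have st := path_sorted xt.
case: r => [|r] /=; last first.
  have := nth_desc r xt; rewrite /= => le1.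
  have small m : nth 0 (x :: t) m <= x by exact: (@nth_le_head (x :: t) m xt).
  have [ix|xi] := ltnP i x; first by rewrite add1n ltnS IH.
  rewrite add0n; have /= H := small r.+1.
  have -> : (i < nth 0 t r) = false by lia.
  rewrite (eq_in_count (a2 := pred0)) ?count_pred0 // => p pt /=.
  have /(nthP 0)[m _ <-] := pt; have /= := small m.+1; lia.
have [ix|xi] := ltnP i x; first by [].
rewrite add0n (eq_in_count (a2 := pred0)) ?count_pred0 // => p pt /=.
have small m : nth 0 (x :: t) m <= x by exact: (@nth_le_head (x :: t) m xt).
by have /(nthP 0)[m _ <-] := pt; have /= := small m.+1; lia.
Qed.

Lemma count_conj_part la r : sorted geq la ->
  count (leq r.+1) (conj_part la) = nth 0 la r.
Proof.
move=> sla; rewrite /conj_part count_map.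
rewrite (eq_count (a2 := fun i => i < nth 0 la r)); last first.
  by move=> i /=; rewrite leq_count_desc.
have := nth_le_head r sla.
move: (nth 0 la r) (head 0 la) => m h mh.
rewrite -size_filter; have -> : h = m + (h - m) by lia.
rewrite iotaD filter_cat size_cat.
rewrite (eq_in_filter (a2 := predT)); last by move=> i; rewrite mem_iota.
rewrite filter_predT size_iota (eq_in_filter (a2 := pred0)) ?filter_pred0 ?addn0 //.
by move=> i; rewrite mem_iota /= => H; apply/negbTE; lia.
Qed.

(** Positive sequences are told apart by their counts above each positive
    threshold. *)
Lemma perm_eq_counts s t : all (leq 1) s -> all (leq 1) t ->
  (forall r, count (leq r.+1) s = count (leq r.+1) t) -> perm_eq s t.
Proof.
move=> s1 t1 st; apply/allP => y _ /=; apply/eqP.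
have split r (z : seq nat) : count (leq r) z = count_mem r z + count (leq r.+1) z.
  elim: z => //= a z ->.
  by case: (ltngtP r a) => //= *; lia.
case: y => [|y]; last by apply: (@addIn (count (leq y.+2) s)); rewrite {2}st -!split st.
have z0 z : all (leq 1) z -> count_mem 0 z = 0.
  by move=> /allP z1; apply/count_memPn/negP => /z1.
by rewrite !z0.
Qed.

End DecreasingInsertion.

(** The truncated subtraction reflects that all levels up to [l] coincide. *)
Lemma count_letters_Phi n l (s : seq (queue_row n)) r :
  count (leq r) (letters (Phi_from l s)) =
    nth 0 (sort_desc [seq size (enum_mset A) | A <- s]) (r - l).
Proof.
elim: s l r => [|A s IH] l r.
  rewrite nth_nil count_lettersE big1 // => j _; exact: profile_empty.
rewrite [LHS]count_letters_row_op ?Phi_from_letters // !IH /=.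
rewrite nth_insert_desc ?sort_desc_sorted // row_sizeE subSS.
have [lr|rl] := ltnP l r.
  by have -> : r - l = (r - l.+1).+1 by lia.
by rewrite subnn; have -> : r - l = 0 by lia.
Qed.

Lemma Phi_type n L (alpha : L.-tuple nat) la (D : L.-tuple (queue_row n)) :
  is_partition la -> rearranges_to alpha la -> bMLQ alpha D ->
  multiset_words (conj_part la) (Phi D).
Proof.
move=> sla perm Da; rewrite /multiset_words /= Phi_fromE.
apply: perm_eq_counts; first exact: Phi_from_letters.
  by apply/allP => y; rewrite mem_filter => /andP[].
move=> r; rewrite count_letters_Phi subn1 /=.
have -> : [seq size (enum_mset A) | A <- D] = alpha.
  apply: (congr1 val (x := map_tuple (fun A => size (enum_mset A)) D)).
  by apply: eq_from_tnth => k; rewrite tnth_map Da.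
rewrite (nth_sort_desc _ sla perm) -count_conj_part // count_filter.
by apply: eq_count => -[|y] //=; rewrite andbT.
Qed.

(** * Irreducibility of the hops *)

Section Irreducible.
Variable n : nat.
Implicit Types (w : word n) (i j k : 'I_n) (ps base : seq (nat * 'I_n)).
Implicit Types (ys : seq nat) (js ks : seq 'I_n).

Definition hop_closed (S : word n -> Prop) :=
  forall w i, S w -> S (hop_or_stay w i).

(** Reachability by hops, as membership in every hop-closed set. *)
Definition reaches w w' := forall S, hop_closed S -> S w -> S w'.

Lemma reaches_trans w2 w1 w3 : reaches w1 w2 -> reaches w2 w3 -> reaches w1 w3.
Proof. by move=> r12 r23 S HS /(r12 S HS)/(r23 S HS). Qed.

(** A word given as a list of particles, which separates the letters from
    their positions. *)
Definition place ps : word n :=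
  [tuple seq_mset [seq p.1 | p <- ps & p.2 == j] | j < n].

Lemma profile_place ps r j :
  profile (place ps) r j = count (fun p => (r <= p.1) && (p.2 == j)) ps.
Proof. by rewrite /profile tnth_mktuple count_seq_mset count_map count_filter. Qed.

Lemma perm_place ps ps' : perm_eq ps ps' -> place ps = place ps'.
Proof.
by move=> /permP psps'; apply: word_eq => r j; rewrite !profile_place psps'.
Qed.

(** With the larger letters out of the way at the next site, the hop at [k]
    moves a copy of [y]. *)
Lemma place_hop ys y k base :
  ordS k != k -> (forall b, b \in base -> b.1 <= y) ->
  hop_or_stay (place (zip ys (nseq (size ys) (ordS k)) ++ (y, k) :: base)) k
    = place (zip ys (nseq (size ys) (ordS k)) ++ (y, ordS k) :: base).
Proof.
move=> kk ymax; apply: word_eq => r j; rewrite profile_hop /slide !profile_place.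
rewrite !count_cat /=; set z := zip _ _.
have z0 : count (fun p => (r <= p.1) && (p.2 == k)) z = 0.
  apply/eqP; rewrite -leqn0 leqNgt -has_count; apply/hasP.
  move=> -[[a b] /= az /andP[_ /eqP bk]].
  have : b \in nseq (size ys) (ordS k).
    have <- : unzip2 z = nseq (size ys) (ordS k).
      by rewrite unzip2_zip // size_nseq.
    by apply/mapP; exists (a, b).
  by rewrite mem_nseq bk eq_sym (negbTE kk) andbF.
rewrite z0 eqxx andbT add0n.
have [ry|yr] := leqP r y; first by rewrite /= [k == j]eq_sym [ordS k == j]eq_sym; lia.
have -> : count (fun p => (r <= p.1) && (p.2 == k)) base = 0.
  apply/eqP; rewrite -leqn0 leqNgt -has_count; apply/hasP => -[b /ymax by_ /andP[rb _]].
  by have := leq_trans rb by_; lia.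
by [].
Qed.

Lemma val_iter_ordS m k : iter m (@ordS n) k = (k + m) %% n :> nat.
Proof.
elim: m => [|m IH] /=; first by rewrite addn0 modn_small.
by rewrite IH addnS -addn1 modnDml addn1.
Qed.

Lemma iter_ordS_to k k' : exists m, iter m (@ordS n) k = k'.
Proof.
exists (k' + n - k); apply: val_inj; rewrite /= val_iter_ordS.
have kn := ltn_ord k; have -> : k + (k' + n - k) = k' + n by lia.
by rewrite modnDr modn_small.
Qed.

(** With letters in decreasing order, the first ones can be moved at will
    while the others stay fixed, by induction on their number: to move the last
    of them one step, park the larger ones on the next site, hop, and bring them
    back.  Iterating goes around the circle.  A circle with one site is
    exceptional, since there is no other site to park on, but then there is a
    single position. *)
Lemma reaches_place ys base js js' :
  sorted geq ys -> (forall y b, y \in ys -> b \in base -> b.1 <= y) ->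
  size js = size ys -> size js' = size ys ->
  reaches (place (zip ys js ++ base)) (place (zip ys js' ++ base)).
Proof.
have [n1|n2] := leqP n 1.
  move=> _ _ sj sj'; suff -> : js = js' by move=> S.
  move: sj'; rewrite -sj => {sj}; elim: js js' => [|j js IH] [|j' js'] //= [] /IH ->.
  by congr (_ :: _); apply: val_inj => /=; have := ltn_ord j; have := ltn_ord j'; lia.
elim/last_ind: ys base js js' => [|ys y IH] base js js'.
  by move=> _ _ /size0nil -> /size0nil ->.
rewrite size_rcons => ysorted ymax.
case/lastP: js => [//|ks k]; case/lastP: js' => [//|ks' k'].
rewrite !size_rcons => -[sk] [sk']; rewrite !zip_rcons // !cat_rcons.
have ysorted' : sorted geq ys.
  by move: ysorted; rewrite -cats1 => /cat_sorted2[].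
have yle z : z \in ys -> y <= z.
  move: ysorted; rewrite (sorted_pairwise geq_trans) pairwise_rcons.
  by move=> /andP[/allP H _]; apply: H.
have kmax z b l : z \in ys -> b \in (y, l) :: base -> b.1 <= z.
  move=> zys; rewrite inE => /orP[/eqP-> /=|bb]; first exact: yle.
  by apply: ymax => //; rewrite mem_rcons inE zys orbT.
have move_others l ls ls' : size ls = size ys -> size ls' = size ys ->
    reaches (place (zip ys ls ++ (y, l) :: base))
            (place (zip ys ls' ++ (y, l) :: base)).
  by move=> *; apply: IH => // z b; apply: kmax.
have step l : reaches (place (zip ys ks ++ (y, l) :: base))
                      (place (zip ys ks ++ (y, ordS l) :: base)).
  apply: (reaches_trans (w2 := place
    (zip ys (nseq (size ys) (ordS l)) ++ (y, l) :: base))).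
    by apply: move_others; rewrite // size_nseq.
  apply: (reaches_trans (w2 := place
    (zip ys (nseq (size ys) (ordS l)) ++ (y, ordS l) :: base))); last first.
    by apply: move_others; rewrite // size_nseq.
  move=> S HS /(HS _ l); rewrite place_hop //; last first.
    by move=> b; apply: ymax; rewrite mem_rcons inE eqxx.
  apply/eqP => /(congr1 val) /=; have ln := ltn_ord l.
  have [ln'|ln'] := ltnP l.+1 n; first by rewrite modn_small //; lia.
  have -> : l.+1 = n by lia.
  by rewrite modnn; lia.
apply: reaches_trans (move_others k' _ _ sk sk').
have [m <-] := iter_ordS_to k k'.
elim: m => [|m IHm] //=; exact: reaches_trans IHm (step _).
Qed.

Lemma word_as_place w : exists ps,
  [/\ w = place ps, sorted geq (unzip1 ps) & perm_eq (unzip1 ps) (letters w)].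
Proof.
pose ps0 := flatten [seq [seq (y, j) | y <- enum_mset (tnth w j)] | j <- enum 'I_n].
pose ps := sort (relpre fst geq) ps0.
have psps0 : perm_eq ps ps0 by rewrite perm_sort.
exists ps; split.
- rewrite (perm_place psps0); apply: word_eq => r j.
  rewrite profile_place count_flatten -map_comp sumnE big_map big_enum /=.
  rewrite (bigD1 j) //= big1 ?addn0 => [|j' /negbTE j'j]; rewrite count_map.
    by apply: eq_count => y /=; rewrite eqxx andbT.
  rewrite (eq_count (a2 := pred0)) ?count_pred0 // => y /=.
  by rewrite j'j andbF.
- rewrite sorted_map; apply: sort_sorted => p q /=; exact: leq_total.
- apply: perm_trans (perm_map fst psps0) _.
  have -> : letters w = flatten [seq enum_mset (tnth w j) | j <- enum 'I_n].
    by rewrite /letters -[in LHS](map_tnth_enum w) -map_comp.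
  rewrite /ps0 map_flatten -map_comp.
  rewrite (eq_map (g := fun j => enum_mset (tnth w j) : seq nat)) // => j /=.
  by rewrite -map_comp map_id.
Qed.

Lemma perm_letters_reaches w w' : perm_eq (letters w) (letters w') -> reaches w w'.
Proof.
have [ps [wE s p]] := word_as_place w; have [ps' [wE' s' p']] := word_as_place w'.
move=> ww'; have ysE : unzip1 ps' = unzip1 ps.
  apply: (sorted_eq geq_trans geq_anti) => //.
  by rewrite (perm_trans p') // perm_sym (perm_trans p).
have := @reaches_place (unzip1 ps) [::] (unzip2 ps) (unzip2 ps') s.
have zE : zip (unzip1 ps) (unzip2 ps') = ps' by rewrite -ysE zip_unzip.
rewrite !cats0 zip_unzip zE -wE -wE'; apply=> //; first by rewrite !size_map.
by rewrite -ysE !size_map.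
Qed.

End Irreducible.

(** * Projection of the chains *)

Import GRing.Theory.

(** The image contains one word of the right type and is stable under hops by
    [Phi_ring_step], so it contains all words that hops reach. *)
Lemma Phi_surjective n L (alpha : L.-tuple nat) la (w : word n) :
  0 < n -> is_partition la -> rearranges_to alpha la ->
  multiset_words (conj_part la) w ->
  exists2 D : L.-tuple (queue_row n), bMLQ alpha D & Phi D = w.
Proof.
move=> hn sla perm ww.
(* Any queue of the right type will do: all particles on one site. *)
pose D0 : L.-tuple (queue_row n) := [tuple msetn (tnth alpha k) (Ordinal hn) | k < L].
have D0a : bMLQ alpha D0.
  by move=> k; rewrite tnth_mktuple enum_msetn size_nseq.
have D0w : perm_eq (letters (Phi D0)) (letters w).
  by rewrite (perm_trans (Phi_type sla perm D0a)) // perm_sym.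
apply: (perm_letters_reaches D0w
  (S := fun w => exists2 D : L.-tuple (queue_row n), bMLQ alpha D & Phi D = w)).
  move=> _ i [D Da <-]; exists (ring_step D i); first exact: ring_step_type.
  exact: Phi_ring_step.
by exists D0.
Qed.

(** Exchange of the finitely supported sum over states with the sum over
    transitions. *)
Lemma fsbig_fiber (R : zmodType) (S T : choiceType) n (X : set S) (f : 'I_n -> S)
    (p : S -> T) (c : 'I_n -> R) b :
  (forall i, X (f i)) ->
  (\sum_(a \in [set a | X a /\ p a = b]%classic) \sum_(i < n | f i == a) c i
    = \sum_(i < n | p (f i) == b) c i)%R.
Proof.
move=> Xf; pose r := undup [seq a <- [seq f i | i <- enum 'I_n] | p a == b].
have mem_r i : (f i \in r) = (p (f i) == b).
  by rewrite mem_undup mem_filter map_f ?mem_enum // andbT.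
rewrite (fsbigE r) ?undup_uniq //; first last.
- move=> a [_ pa] ar; apply: big1 => i /eqP fia; case/negP: ar.
  by rewrite -fia mem_r fia; apply/eqP.
- move=> a /=; rewrite mem_undup mem_filter => /andP[/eqP pa /mapP[i _ ai]].
  by split=> //; rewrite ai.
rewrite (exchange_big_dep predT) //= [RHS]big_mkcond; apply: eq_bigr => i _.
rewrite -mem_r; case: ifP => fir.
  rewrite big_mkcond (bigD1_seq (f i)) ?undup_uniq //= eqxx andbT big1.
    by rewrite addr0 mem_set //; split=> //; apply/eqP; rewrite -mem_r.
  by move=> a /negbTE; rewrite eq_sym => ->; rewrite andbF.
rewrite big_seq_cond big1 // => a /and3P[ar _ /eqP fia].
by rewrite fia ar in fir.
Qed.

Theorem theorem5p7 (R : realType) (n : nat) (hn : (0 < n)%N)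
    (x : 'I_n -> R) (hx : forall i : 'I_n, (0 < x i)%R)
    (L : nat) (alpha : L.-tuple nat) (la : seq nat)
    (hla : is_partition la) (halpha : rearranges_to alpha la) :
  projects_to (bMLQ_chain x alpha) (TAZRP0 x (conj_part la))
    (@Phi n L).
Proof.
split.
  apply/seteqP; split=> [_ [D Da <-]|w ww]; first exact: (Phi_type hla halpha Da).
  by have [D Da Dw] := Phi_surjective hn hla halpha ww; exists D.
move=> b b' D _ _ bb' Da Db /=.
rewrite (fsbig_fiber (f := ring_step D)); last by move=> i; apply: ring_step_type Da.
rewrite big_mkcond [RHS]big_mkcond; apply: eq_bigr => i _.
rewrite Phi_ring_step Db /hop_or_stay.
have [bi|bi] /= := eqVneq (tnth b i) mset0.
  by case: eqP.
by rewrite (@Phi_nonempty _ _ D i) // Db.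
Qed.
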